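(* Let $p\in(1,\infty)$, let $Q\subset\mathbb{R}^d$ be open, and let $\langle\cdot\rangle$ be ergodic. Let $\{\mathcal{E}^\omega_\varepsilon:L^p(Q)\to\mathbb{R}\cup\{\infty\}\}_{\omega\in\Omega}$ ($\varepsilon>0$) be a family of random functionals and put $\mathcal{E}_\varepsilon:L^p(\Omega\times Q)\to\mathbb{R}\cup\{\infty\}$, $\mathcal{E}_\varepsilon(u)=\langle\mathcal{E}^\omega_\varepsilon(u(\omega))\rangle$. Assume there exist $\Omega'\subset\Omega$ with $P(\Omega')=1$, $C>0$ and $\psi\in L^1(\Omega)$ such that: (C1) The map $\Omega\times L^p(Q)\ni(\omega,u)\mapsto\mathcal{E}^\omega_\varepsilon(u)$ is $\mathcal{F}\otimes\mathcal{B}(L^p(Q))$-measurable. For all $\omega\in\Omega'$: $\mathcal{E}^\omega_\varepsilon\ge-C$, $\inf_u\mathcal{E}^\omega_\varepsilon(u)\le\psi(\omega)$, and $\mathcal{E}^\omega_\varepsilon$ is convex, proper and lower semicontinuous. (C2) $dom(\mathcal{E}^\omega_\varepsilon)=X\subset W^{1,p}(Q)$, where $X$ is convex, closed and compactly embedded in $L^p(Q)$, and for all $\omega\in\Omega'$, $\mathcal{E}^\omega_\varepsilon(u)\ge\frac1C\|u\|^p_{W^{1,p}(Q)}-C$ for all $u\in L^p(Q)$. (C3) There exist $\mathcal{E}_{\mathsf{hom}},\widetilde{\mathcal{E}}_{\mathsf{hom}}:L^p(Q)\to\mathbb{R}\cup\{\infty\}$ such that for all $\omega\in\Omega'$, $\mathcal{E}^\omega_\varepsilon\overset{\Gamma}{\to}\mathcal{E}_{\mathsf{hom}}$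 in $L^p(Q)$ as $\varepsilon\to0$, and $\mathcal{E}_\varepsilon$ converges to $\widetilde{\mathcal{E}}_{\mathsf{hom}}$ in the following sense: (i) if $u_\varepsilon\overset{2s}{\rightharpoonup}u$ with $u\in L^p(Q)$, then $\liminf_{\varepsilon\to0}\mathcal{E}_\varepsilon(u_\varepsilon)\ge\widetilde{\mathcal{E}}_{\mathsf{hom}}(u)$; (ii) for every $u\in L^p(Q)$ there exist $u_\varepsilon\in L^p(\Omega\times Q)$ such that $u_\varepsilon\overset{2s}{\rightharpoonup}u$ and $\mathcal{E}_\varepsilon(u_\varepsilon)\to\widetilde{\mathcal{E}}_{\mathsf{hom}}(u)$. Then $\mathcal{E}_{\mathsf{hom}}=\widetilde{\mathcal{E}}_{\mathsf{hom}}$.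
   Context: Standing assumption: $(\Omega,\mathcal{F},P)$ is a probability space with countably generated $\sigma$-algebra, and $\tau=\{\tau_x\}_{x\in\mathbb{R}^d}$ is a group of measurable bijections of $\Omega$ with $\tau_0=\mathrm{Id}$, $\tau_{x+y}=\tau_x\circ\tau_y$, $P(\tau_xA)=P(A)$ for $A\in\mathcal{F}$, and $(\omega,x)\mapsto\tau_x\omega$ is $\mathcal{F}\otimes\mathcal{L}$-measurable ($\mathcal{L}$ the Lebesgue $\sigma$-algebra on $\mathbb{R}^d$). $\langle\cdot\rangle:=\int_\Omega\cdot\,dP$; it is ergodic if every $A\in\mathcal{F}$ with $\tau_xA=A$ for all $x$ satisfies $P(A)\in\{0,1\}$. $\mathcal{B}(L^p(Q))$ is the Borel $\sigma$-algebra, and $dom(\mathcal{E})=\{\mathcal{E}<\infty\}$. Unfolding: for $\varepsilon>0$, $\mathcal{T}_\varepsilon:L^p(\Omega\times Q)\to L^p(\Omega\times Q)$ is the unique linear isometric isomorphism with $(\mathcal{T}_\varepsilon u)(\omega,x)=u(\tau_{-x/\varepsilon}\omega,x)$ a.e. for $u$ in the algebraic tensor product of $L^p(\Omega)$ and $L^p(Q)$. $u_\varepsilon\overset{2s}{\rightharpoonup}u$ (weak two-scale convergence in the mean) means $\mathcal{T}_\varepsilon u_\varepsilon\rightharpoonup u$ weakly in $L^p(\Omega\times Q)$ as $\varepsilon\to0$; functions in $L^p(Q)$ are regarded as functions on $\Omega\times Q$ constant in $\omega$. $\overset{\Gamma}{\to}$ in $L^p(Q)$ is $\Gamma$-convergence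 with respect to the strong topology of $L^p(Q)$. *)

(* Defs.v *)
From HB Require Import structures.
From mathcomp Require Import all_boot all_order all_algebra.
From mathcomp Require Import all_classical all_reals all_analysis.
From mathcomp Require Import measurable_realfun ess_sup_inf lra.
Set Implicit Arguments.
Unset Strict Implicit.
Unset Printing Implicit Defensive.
Import Order.TTheory GRing.Theory Num.Theory.
Import numFieldNormedType.Exports.
Local Open Scope classical_set_scope.
Local Open Scope ring_scope.

Section lebesgue_rV.
Context (R : realType) (n : nat).
Implicit Types (a b x : 'rV[R]_n) (A B X : set 'rV[R]_n).

Definition rect a b : set 'rV[R]_n :=
  [set x | forall i, a ord0 i < x ord0 i <= b ord0 i].

Definition rect_vol a b : R := \prod_(i < n) Num.max 0 (b ord0 i - a ord0 i).

Definition rect_cover A (D : set nat) (a b : nat -> 'rV[R]_n) :=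
  A `<=` \bigcup_(k in D) rect (a k) (b k).

(* Lebesgue outer measure: infimum of the total volumes of the countable
   families of half-open rectangles covering A. The index set D lets the family
   be empty or finite, which matters when n = 0 since then no rectangle is
   empty. *)
Definition lebesgue_outer A : \bar R :=
  ereal_inf [set s | exists (D : set nat) (a b : nat -> 'rV[R]_n),
    rect_cover A D a b /\ s = \esum_(k in D) (rect_vol (a k) (b k))%:E].

Lemma rect_vol_ge0 a b : 0 <= rect_vol a b.
Proof. by apply: prodr_ge0 => i _; rewrite le_max lexx. Qed.

Let outer_ge0 A : (0 <= lebesgue_outer A)%E.
Proof.
apply: le_ereal_inf_tmp => _ [D [a [b [_ ->]]]].
by apply: esum_ge0 => k _; rewrite lee_fin rect_vol_ge0.
Qed.

Let outer0 : lebesgue_outer set0 = 0%E.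
Proof.
apply/eqP; rewrite eq_le outer_ge0 andbT; apply: ereal_inf_lbound.
by exists set0, (fun=> 0), (fun=> 0); split; rewrite ?esum_set0.
Qed.

Let outer_le : {homo lebesgue_outer : A B / A `<=` B >-> (A <= B)%E}.
Proof.
move=> A B AB; apply: ereal_inf_le_tmp => _ [D [a [b [Bc ->]]]].
by exists D, a, b; split => //; exact: subset_trans Bc.
Qed.

Let outer_sub : sigma_subadditive lebesgue_outer.
Proof.
move=> A; have [[i ioo]|] := pselect (exists i, lebesgue_outer (A i) = +oo%E).
  rewrite (eseries_pinfty _ _ ioo) ?leey// => k _.
  by rewrite -ltNye (lt_le_trans _ (outer_ge0 _)).
rewrite -forallNE => Aoo.
suff add2e (e : {posnum R}) : (lebesgue_outer (\bigcup_k A k) <=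
    \sum_(i <oo) lebesgue_outer (A i) + e%:num%:E)%E.
  by apply/lee_addgt0Pr => _/posnumP[].
rewrite (le_trans _ (epsilon_trick _ _ _))//.
pose vol (c : (nat -> 'rV[R]_n) * (nat -> 'rV[R]_n)) k : \bar R :=
  (rect_vol (c.1 k) (c.2 k))%:E.
have vol0 c k : (0 <= vol c k)%E by rewrite lee_fin rect_vol_ge0.
pose P k (c : set nat * ((nat -> 'rV[R]_n) * (nat -> 'rV[R]_n))) :=
  rect_cover (A k) c.1 c.2.1 c.2.2 /\
  (\esum_(j in c.1) vol c.2 j <=
    lebesgue_outer (A k) + (e%:num / (2 ^ k.+1)%:R)%:E)%E.
have [G PG] : {G & forall k, P k (G k)}.
  apply: (@choice _ _ P) => k; rewrite /P.
  have en1 : (0 < e%:num / (2 ^ k.+1)%:R) by [].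
  have fA : lebesgue_outer (A k) \is a fin_num.
    by rewrite ge0_fin_numE// ltey; apply/eqP; exact: Aoo.
  have [_ [D [a [b [Ac ->]]]] /ltW h] := lb_ereal_inf_adherent en1 fA.
  by exists (D, (a, b)).
have /card_esym/ppcard_eqP[f] := card_nat2.
pose D' : set nat := f @^-1` ([set: nat] `*`` (fun k => (G k).1)).
pose g z : \bar R := vol (G z.1).2 z.2.
apply: (@le_trans _ _ (\esum_(j in D') g (f j))).
  apply: ereal_inf_lbound; exists D', (fun j => (G (f j).1).2.1 (f j).2),
    (fun j => (G (f j).1).2.2 (f j).2); split => //.
  move=> x [k _ /(PG k).1[j Dj xj]].
  have fK : f (f^-1%FUN (k, j)) = (k, j) by rewrite invK ?inE.
  by exists (f^-1%FUN (k, j)); rewrite /D' /= fK.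
rewrite -(@reindex_esum _ _ _ D' ([set: nat] `*`` (fun k => (G k).1)) f g);
  last first.
  split.
  - by [].
  - by move=> x y _ _; exact: (@inj _ _ _ f _ _ (mem_set I) (mem_set I)).
  - by move=> z Dz; exists (f^-1%FUN z); rewrite /D' /= ?invK ?inE.
rewrite -(@esum_esum _ _ _ _ _ (fun k j => vol (G k).2 j))//.
rewrite -nneseries_esumT; last by move=> k; exact: esum_ge0.
apply: lee_nneseries => k _; first by move=> _; exact: esum_ge0.
exact: (PG k).2.
Qed.

HB.instance Definition _ := isOuterMeasure.Build R 'rV[R]_n lebesgue_outer
  outer0 outer_ge0 outer_le outer_sub.

Let split_vol (a b c : R) :
  Num.max 0 (Num.min b c - a) + Num.max 0 (b - Num.max a c) = Num.max 0 (b - a).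
Proof.
by rewrite /Num.max /Num.min; do !case: ifP; move=> *; lra.
Qed.

Definition slide (v : 'rV[R]_n) i (t : R) : 'rV[R]_n :=
  \row_j if j == i then t else v ord0 j.

Lemma halfspace_caratheodory (i : 'I_n) (c : R) :
  lebesgue_outer.-caratheodory [set x : 'rV[R]_n | x ord0 i <= c].
Proof.
set H := [set x | _]; apply: le_caratheodory_measurable => X.
apply: le_ereal_inf_tmp => _ [D [a [b [Xc ->]]]].
pose b' k := slide (b k) i (Num.min (b k ord0 i) c).
pose a' k := slide (a k) i (Num.max (a k ord0 i) c).
have volE k :
    rect_vol (a k) (b' k) + rect_vol (a' k) (b k) = rect_vol (a k) (b k).
  rewrite /rect_vol (bigD1 i)//= [X in _ + X](bigD1 i)//= [RHS](bigD1 i)//=.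
  rewrite !mxE eqxx.
  under eq_bigr => j ji do rewrite mxE (negbTE ji).
  under [X in _ + _ * X]eq_bigr => j ji do rewrite mxE (negbTE ji).
  by rewrite -mulrDl split_vol.
rewrite (eq_esum (b := fun k =>
    ((rect_vol (a k) (b' k))%:E + (rect_vol (a' k) (b k))%:E)%E)); last first.
  by move=> k _; rewrite -EFinD volE.
rewrite esumD; try by move=> k _; rewrite lee_fin rect_vol_ge0.
apply: leeD; apply: ereal_inf_lbound.
- exists D, a, b'; split => // x [/Xc[k Dk xk] xH]; exists k => // j.
  rewrite /b' mxE; have := xk j; case: eqP => [->|_ //] /andP[-> xb] /=.
  by rewrite le_min xb.
- exists D, a', b; split => // x [/Xc[k Dk xk] xH]; exists k => // j.
  rewrite /a' mxE; have := xk j; case: eqP => [->|_ //] /andP[ax ->].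
  by rewrite andbT gt_max ax /= ltNge; apply/negP.
Qed.

(* R^n with the Lebesgue sigma-algebra, i.e. the Caratheodory-measurable sets;
   the underlying type is convertible to 'rV[R]_n. *)
Definition lebesgue_rV := caratheodory_type lebesgue_outer.

Definition lebesgue (A : set lebesgue_rV) : \bar R := lebesgue_outer A.

Lemma rect_measurable a b : measurable (rect a b : set lebesgue_rV).
Proof.
rewrite (_ : rect a b = \bigcap_(i in [set: 'I_n])
    ([set x : 'rV[R]_n | x ord0 i <= b ord0 i] `\`
     [set x : 'rV[R]_n | x ord0 i <= a ord0 i])); last first.
  apply/seteqP; split => [x xab i _|x xab i].
    by have /andP[ax xb] := xab i; split => //=; apply/negP; rewrite -ltNge.
  by have [/= -> /negP] := xab i I; rewrite -ltNge => ->.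
apply: fin_bigcap_measurable; first exact: finite_finset.
move=> i _; apply: measurableD; exact: halfspace_caratheodory.
Qed.

Lemma open_lebesgue_measurable (Q : set 'rV[R]_n) :
  open Q -> measurable (Q : set lebesgue_rV).
Proof.
move=> oQ; pose rv (r : 'rV[rat]_n) : 'rV[R]_n := map_mx ratr r.
pose D := [set r : 'rV[rat]_n * 'rV[rat]_n | rect (rv r.1) (rv r.2) `<=` Q].
rewrite (_ : Q = \bigcup_(r in D) rect (rv r.1) (rv r.2)).
  rewrite bigcup_mkcond; apply: countable_bigcupT_measurable => // r.
  by case: ifP => _; [exact: rect_measurable|exact: measurable0].
apply/seteqP; split => [x Qx|x [r Dr /Dr]//].
have /nbhs_ballP[e /= e0 xeQ] : nbhs x Q by exact: open_nbhs_nbhs.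
have lo (i : 'I_n) : {q : rat | x ord0 i - e < ratr q < x ord0 i}.
  by apply/cid; apply: rat_in_itvoo; rewrite ltrBlDr ltrDl.
have hi (i : 'I_n) : {q : rat | x ord0 i < ratr q < x ord0 i + e}.
  by apply/cid; apply: rat_in_itvoo; rewrite ltrDl.
exists (\row_i sval (lo i), \row_i sval (hi i)) => [y /= yab|i /=].
  apply: xeQ; split => // i j; rewrite (ord1 i) /ball /=.
  have := yab j; rewrite !mxE; have /andP[? ?] := svalP (lo j).
  have /andP[? ?] := svalP (hi j); rewrite ltr_norml => /andP[? ?].
  by apply/andP; split; lra.
rewrite !mxE; have /andP[_ ->] := svalP (lo i).
by have /andP[/ltW -> _] := svalP (hi i).
Qed.

HB.instance Definition _ := isMeasure.Build _ lebesgue_rV R lebesgue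
  (@caratheodory_measure0 _ _ lebesgue_outer)
  (@caratheodory_measure_ge0 _ _ lebesgue_outer)
  (@caratheodory_measure_sigma_additive _ _ lebesgue_outer).

Let lebesgue_sigma_finite : sigma_finite setT lebesgue.
Proof.
exists (fun k : nat => rect (const_mx (- k%:R)) (const_mx k%:R)) => [|k].
  apply/seteqP; split => // x _.
  exists (Num.truncn `|x|).+1 => // i; rewrite !mxE.
  have xk : `|x ord0 i| < (Num.truncn `|x|).+1%:R.
    apply: le_lt_trans (truncnS_gt _).
    rewrite [leRHS]/Num.norm /= mx_normrE; apply/bigmax_geP; right.
    by exists (ord0, i).
  by move: xk; rewrite ltr_norml => /andP[-> /ltW ->].
split; first exact: rect_measurable.
apply: (@le_lt_trans _ _ (rect_vol (const_mx (- k%:R)) (const_mx k%:R))%:E).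
  apply: ereal_inf_lbound; exists [set 0%N], (fun=> const_mx (- k%:R)),
    (fun=> const_mx k%:R); split; last first.
    by rewrite esum_set1// lee_fin rect_vol_ge0.
  by move=> x kx; exists 0%N.
by rewrite ltry.
Qed.

HB.instance Definition _ :=
  Measure_isSigmaFinite.Build _ lebesgue_rV R lebesgue lebesgue_sigma_finite.

End lebesgue_rV.

Section Lspace_classes.
Context d (T : measurableType d) (R : realType).
Variables (mu : {measure set T -> \bar R}) (p : \bar R) (p1 : (1 <= p)%E).
Notation L := (LspaceType mu p1).

Lemma ae_eq_Lnorm (f g : T -> R) : measurable_fun setT f ->
  measurable_fun setT g -> f = g %[ae mu] ->
  ('N[mu]_p [EFin \o f] = 'N[mu]_p [EFin \o g])%E.
Proof.
move=> mf mg fg; rewrite unlock; case: p p1 => [r r1| _|//].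
- have pw (h : T -> R) : measurable_fun setT h ->
      measurable_fun setT (fun x => `|(EFin \o h) x| `^ r)%E.
    move=> mh; apply: (@measurableT_comp _ _ _ _ _ _ (@poweR R ^~ r)).
      exact: measurable_poweR.
    apply: measurableT_comp; first exact: abse_measurable.
    exact/measurable_EFinP.
  congr (_ `^ _)%E; apply: ge0_ae_eq_integral => //.
  + exact: pw.
  + exact: pw.
  + by move=> x _; exact: poweR_ge0.
  + by move=> x _; exact: poweR_ge0.
  + by apply: filterS fg => x /(_ I) /= -> _.
- case: ifP => // _; rewrite !ess_supEae; congr ereal_inf.
  by apply/seteqP; split => y /=; apply: filterS2 fg => x /(_ I) /= ->.
Qed.

Lemma Lspace_measurable (u : L) : measurable_fun setT (u : T -> R).
Proof. exact: (@measurable_funPT _ _ _ _ (repr (u : {mfun_ mu, T >-> _}))). Qed.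

Lemma Lspace_Lfun (u : L) : (u : T -> R) \in Lfun mu p.
Proof.
rewrite !inE; apply/andP; split; apply/mem_set.
  exact: Lspace_measurable.
by case: u => u [[]].
Qed.

Lemma Lspace_eqP (u v : L) : (u : T -> R) = v %[ae mu] -> u = v.
Proof.
move=> uv; have uvE : u = v :> {mfun_ mu, T >-> measurableTypeR R}.
  by rewrite -[LHS]reprK -[RHS]reprK; apply/eqquotP/asboolP.
case: u v uvE {uv} => u [[hu]] [v [[hv]]] /= uv; subst v.
congr LebesgueSpace.Pack; congr LebesgueSpace.Class.
by congr isFinLebesgue.Axioms_; exact: Prop_irrelevance.
Qed.

Section mk.
Variables (f : T -> R) (fL : f \in Lfun mu p).

Let f_meas : measurable_fun setT (f : T -> measurableTypeR R).
Proof. by move: (sub_Lfun_mfun fL); rewrite inE. Qed.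

Let f_mfun : {mfun T >-> measurableTypeR R} :=
  HB.pack f (isMeasurableFun.Build _ _ T (measurableTypeR R) f f_meas).

Let f_ae : {mfun_ mu, T >-> measurableTypeR R} :=
  (\pi_({mfun_ mu, T >-> measurableTypeR R}) f_mfun)%qT.

Let f_aeE : (f_ae : T -> R) = f %[ae mu].
Proof.
have : (repr f_ae = f_mfun %[mod {mfun_ mu, T >-> measurableTypeR R}])%qT.
  by rewrite reprK.
by move/eqquotP/asboolP.
Qed.

Let f_fin : finite_norm mu p f_ae.
Proof.
rewrite /finite_norm (@ae_eq_Lnorm _ f) //.
- by move: (sub_Lfun_finLfun fL); rewrite inE.
- exact: (@measurable_funPT _ _ _ _ (repr f_ae)).
Qed.

Definition Lspace_of : L :=
  HB.pack f_ae (isFinLebesgue.Build _ _ _ mu p p1 f_ae f_fin).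

Lemma Lspace_ofE : (Lspace_of : T -> R) = f %[ae mu].
Proof. exact: f_aeE. Qed.

End mk.
End Lspace_classes.

Section Lspace_lmodule.
Context d (T : measurableType d) (R : realType).
Variables (mu : {measure set T -> \bar R}) (p : \bar R) (p1 : (1 <= p)%E).
Notation L := (LspaceType mu p1).
Implicit Types (u v w : L) (a b : R).

HB.instance Definition _ := gen_eqMixin L.
HB.instance Definition _ := gen_choiceMixin L.

Let aeS (A B : set T) : (forall x, A x -> B x) ->
  nbhs (almost_everywhere mu) A -> nbhs (almost_everywhere mu) B.
Proof. by move=> AB; apply: filterS. Qed.

Let aeI (A B : set T) : nbhs (almost_everywhere mu) A ->
  nbhs (almost_everywhere mu) B -> nbhs (almost_everywhere mu) (A `&` B).
Proof. exact: filterI. Qed.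

Definition Lspace_zero : L := Lspace_of p1 (LfunP (0 : LfunType mu p1)).

(* The class of f in L^p, or the zero class if f is not p-integrable. *)
Definition Lspace_class (f : T -> R) : L :=
  if pselect (f \in Lfun mu p) is left fL then Lspace_of p1 fL else Lspace_zero.

Lemma Lspace_classE f : f \in Lfun mu p ->
  (Lspace_class f : T -> R) = f %[ae mu].
Proof.
by rewrite /Lspace_class; case: pselect => // fL _; exact: Lspace_ofE.
Qed.

Let Lspace_to_Lfun u : LfunType mu p1 := Lfun_Sub p1 (Lspace_Lfun u).

Let add u v := Lspace_class ((u : T -> R) \+ v).
Let opp u := Lspace_class (\- (u : T -> R)).
Let scale a u := Lspace_class (a \*: (u : T -> R)).

Let zeroE : (Lspace_zero : T -> R) = cst 0 %[ae mu].
Proof. exact: Lspace_ofE. Qed.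

Let addE u v : (add u v : T -> R) = (u : T -> R) \+ v %[ae mu].
Proof.
by apply: Lspace_classE; exact: (LfunP (Lspace_to_Lfun u + Lspace_to_Lfun v)).
Qed.

Let oppE u : (opp u : T -> R) = \- (u : T -> R) %[ae mu].
Proof. by apply: Lspace_classE; exact: (LfunP (- Lspace_to_Lfun u)). Qed.

Let scaleE a u : (scale a u : T -> R) = a \*: (u : T -> R) %[ae mu].
Proof. by apply: Lspace_classE; exact: (LfunP (a *: Lspace_to_Lfun u)). Qed.

Let addA : associative add.
Proof.
move=> u v w; apply: Lspace_eqP.
have := aeI (aeI (addE u (add v w)) (addE v w))
                (aeI (addE (add u v) w) (addE u v)).
apply: aeS => x [[/(_ I) h1 /(_ I) h2] [/(_ I) h3 /(_ I) h4]] _ /=.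
by rewrite h1 h3 /= h2 h4 /= addrA.
Qed.

Let addC : commutative add.
Proof.
move=> u v; apply: Lspace_eqP.
apply: aeS (aeI (addE u v) (addE v u)) => x [/(_ I) -> /(_ I) ->] _.
by rewrite /= addrC.
Qed.

Let add0 : left_id Lspace_zero add.
Proof.
move=> u; apply: Lspace_eqP.
apply: aeS (aeI (addE Lspace_zero u) zeroE).
by move=> x [/(_ I) -> /(_ I) /= ->] _; rewrite add0r.
Qed.

Let addN : left_inverse Lspace_zero opp add.
Proof.
move=> u; apply: Lspace_eqP.
apply: aeS (aeI (addE (opp u) u) (aeI zeroE (oppE u))).
by move=> x [/(_ I) -> [/(_ I) /= -> /(_ I) /= ->]] _; rewrite addNr.
Qed.

HB.instance Definition _ := GRing.isZmodule.Build L addA addC add0 addN.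

Let scaleA a b u : scale a (scale b u) = scale (a * b) u.
Proof.
apply: Lspace_eqP.
apply: aeS (aeI (scaleE a (scale b u))
  (aeI (scaleE b u) (scaleE (a * b) u))).
by move=> x [/(_ I) -> [/(_ I) /= -> /(_ I) ->]] _; rewrite /= scalerA.
Qed.

Let scale1 : left_id 1 scale.
Proof.
move=> u; apply: Lspace_eqP; apply: aeS (scaleE 1 u) => x /(_ I) -> _.
by rewrite /= scale1r.
Qed.

Let scaleDr : right_distributive scale +%R.
Proof.
move=> a u v; apply: Lspace_eqP.
have := aeI (aeI (scaleE a (add u v)) (addE u v))
  (aeI (addE (scale a u) (scale a v)) (aeI (scaleE a u) (scaleE a v))).
apply: aeS => x [[/(_ I) h1 /(_ I) h2] [/(_ I) h3 [/(_ I) h4 /(_ I) h5]]] _.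
by rewrite [LHS]h1 [RHS]h3 /= h2 h4 h5 /= scalerDr.
Qed.

Let scaleDl u : {morph scale^~ u : a b / a + b}.
Proof.
move=> a b; apply: Lspace_eqP.
have := aeI (aeI (scaleE (a + b) u) (addE (scale a u) (scale b u)))
  (aeI (scaleE a u) (scaleE b u)).
apply: aeS => x [[/(_ I) h1 /(_ I) h2] [/(_ I) h3 /(_ I) h4]] _.
by rewrite [LHS]h1 [RHS]h2 /= h3 h4 /= scalerDl.
Qed.

HB.instance Definition _ :=
  GRing.Zmodule_isLmodule.Build R L scaleA scale1 scaleDr scaleDl.

Lemma LspaceDE u v : ((u + v : L) : T -> R) = (u : T -> R) \+ v %[ae mu].
Proof. exact: addE. Qed.

Lemma LspaceZE a u : ((a *: u : L) : T -> R) = a \*: (u : T -> R) %[ae mu].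
Proof. exact: scaleE. Qed.

Definition Lspace_norm u : R := fine 'N[mu]_p[EFin \o (u : T -> R)].

Let ler_normD u v : Lspace_norm (u + v) <= Lspace_norm u + Lspace_norm v.
Proof.
rewrite /Lspace_norm (@ae_eq_Lnorm _ _ _ _ _ p1 _ _ _ _ (LspaceDE u v)).
- exact: (ler_LnormD (Lspace_to_Lfun u) (Lspace_to_Lfun v)).
- exact: Lspace_measurable.
- by apply: measurable_funD; exact: Lspace_measurable.
Qed.

Let normZ a u : Lspace_norm (a *: u) = `|a| * Lspace_norm u.
Proof.
rewrite /Lspace_norm (@ae_eq_Lnorm _ _ _ _ _ p1 _ _ _ _ (LspaceZE a u)).
- rewrite (LnormZ (Lspace_to_Lfun u) a).
  by rewrite -(finite_norm_fine (Lspace_to_Lfun u)).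
- exact: Lspace_measurable.
- by apply: measurable_funM => //; exact: Lspace_measurable.
Qed.

Let norm0_eq0 u : Lspace_norm u = 0 -> u = 0.
Proof.
move=> /(fine_Lnormr_eq0 (f := Lspace_to_Lfun u)) u0; apply: Lspace_eqP.
by apply: aeS (aeI u0 zeroE) => x [/(_ I) /= -> /(_ I) ->].
Qed.

HB.instance Definition _ :=
  Lmodule_isNormed.Build R L ler_normD normZ norm0_eq0.

Lemma Lspace_normE u : `|u| = fine 'N[mu]_p[EFin \o (u : T -> R)].
Proof. by []. Qed.

End Lspace_lmodule.

Lemma lt1_le1e (R : realType) (p : R) : 1 < p -> (1 <= p%:E)%E.
Proof. by move=> p1; rewrite lee_fin ltW. Qed.

(* L^p(Q) is L^p of Lebesgue measure restricted to Q: its elements are classes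
   of functions on the whole of R^n modulo equality almost everywhere on Q. *)
Section lebesgue_on.
Context (R : realType) (n : nat) (Q : set 'rV[R]_n) (oQ : open Q).

Definition lebesgue_on : set (lebesgue_rV R n) -> \bar R :=
  mrestr (@lebesgue R n) (open_lebesgue_measurable oQ).

HB.instance Definition _ := Measure.on lebesgue_on.

Let lebesgue_on_sigma_finite : sigma_finite setT lebesgue_on.
Proof.
have [F FT Ffin] := sigma_finiteT (@lebesgue R n).
exists F => // k; have [mF Foo] := Ffin k; split => //.
apply: le_lt_trans Foo; apply: le_measure; rewrite ?inE //.
by apply: measurableI => //; exact: open_lebesgue_measurable.
Qed.

HB.instance Definition _ := Measure_isSigmaFinite.Build _ (lebesgue_rV R n) R
  lebesgue_on lebesgue_on_sigma_finite.

End lebesgue_on.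

Section sobolev.
Context (R : realType) (n : nat) (Q : set 'rV[R]_n) (oQ : open Q).
Context (p : R) (p1 : (1 <= p%:E)%E).
Notation LpQ := (LspaceType (lebesgue_on oQ) p1).

Definition partial (i : 'I_n) (phi : 'rV[R]_n -> R) : 'rV[R]_n -> R :=
  'D_(delta_mx ord0 i) phi.

(* C^infinity: all iterated partial derivatives exist and are continuous. *)
Definition smooth (phi : 'rV[R]_n -> R) := forall s : seq 'I_n,
  continuous (foldr partial phi s) /\
  forall i x, derivable (foldr partial phi s) x (delta_mx ord0 i).

Definition test_function (phi : 'rV[R]_n -> R) :=
  [/\ smooth phi, compact (closure [set x | phi x != 0])
    & closure [set x | phi x != 0] `<=` Q].

Definition weak_partial (u : LpQ) (i : 'I_n) (g : LpQ) :=
  forall phi : 'rV[R]_n -> R, test_function phi ->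
    \int[lebesgue_on oQ]_x (u x * partial i phi x) =
    - \int[lebesgue_on oQ]_x (g x * phi x).

Definition sobolev : set LpQ :=
  [set u | forall i, exists g, weak_partial u i g].

Definition wpartial (u : LpQ) (i : 'I_n) : LpQ :=
  xget 0 [set g | weak_partial u i g].

(* The W^{1,p}(Q) norm, extended by +oo to the functions of L^p(Q) that are
   not in W^{1,p}(Q). *)
Definition sobolev_norm (u : LpQ) : \bar R :=
  if `[< sobolev u >]
  then ((`|u| `^ p + \sum_(i < n) `|wpartial u i| `^ p) `^ p^-1)%:E
  else +oo%E.

Definition sobolev_closed (X : set LpQ) := forall u, sobolev u ->
  (forall e : R, 0 < e -> exists2 v, X v & (sobolev_norm (u - v)%R < e%:E)%E) ->
  X u.

(* Subsets of X that are bounded in W^{1,p}(Q) are relatively compact in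
   L^p(Q). *)
Definition compactly_embedded (X : set LpQ) := forall M : R,
  precompact [set u | X u /\ (sobolev_norm u <= M%:E)%E].

End sobolev.

Section functionals.
Context (R : realType) (V : normedModType R).

Definition edom (F : V -> \bar R) : set V := [set u | (F u < +oo)%E].

Definition proper_functional (F : V -> \bar R) :=
  (forall u, F u != -oo%E) /\ edom F !=set0.

Definition convex_functional (F : V -> \bar R) :=
  forall (u v : V) (t : R), 0 <= t <= 1 ->
    (F (t *: u + (1 - t) *: v)%R <= t%:E * F u + (1 - t)%:E * F v)%E.

(* Families are indexed by the reals e > 0; their values at e <= 0 are
   irrelevant, as all limits are taken along e --> 0^'+. *)
Definition liminf0 (f : R -> \bar R) : \bar R := limf_einf f 0^'+.

Definition weak_cvg0 (u : R -> V) (l : V) :=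
  forall f : {linear V -> R}, continuous f ->
    f (u e) @[e --> 0^'+] --> f l.

Definition gamma_cvg0 (F : R -> V -> \bar R) (G : V -> \bar R) :=
  (forall (u : V) (v : R -> V), v e @[e --> 0^'+] --> u ->
     (G u <= liminf0 (fun e => F e (v e)))%E) /\
  (forall u : V, exists2 v : R -> V, v e @[e --> 0^'+] --> u &
     F e (v e) @[e --> 0^'+] --> G u).

End functionals.

Section stochastic_unfolding.
Context (R : realType) (n : nat) (d : measure_display).
Context (Omega : measurableType d).
Variable P : probability Omega R.

Definition countably_generated :=
  exists F : nat -> set Omega, (measurable : set (set Omega)) = <<s range F >>.

Definition measure_preserving_flow (tau : 'rV[R]_n -> Omega -> Omega) :=
  [/\ tau 0 = id,
      forall x y, tau (x + y) = tau x \o tau y,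
      forall x, bijective (tau x) /\ measurable_fun setT (tau x),
      forall x A, measurable A -> P (tau x @` A) = P A
    & measurable_fun setT
        (fun z : (Omega * lebesgue_rV R n)%type => tau z.2 z.1)].

Definition ergodic (tau : 'rV[R]_n -> Omega -> Omega) :=
  forall A, measurable A -> (forall x, tau x @` A = A) ->
    P A = 0%E \/ P A = 1%E.

Context (Q : set 'rV[R]_n) (oQ : open Q) (p : R) (p1 : (1 <= p%:E)%E).
Notation LpQ := (LspaceType (lebesgue_on oQ) p1).
Notation LpOQ := (LspaceType (P \x lebesgue_on oQ)%E p1).

(* T is the unfolding operator at scale e. The last clause determines T on the
   algebraic tensor product of L^p(Omega) and L^p(Q), which is dense, so there
   is at most one such T. *)
Definition unfolding (tau : 'rV[R]_n -> Omega -> Omega) (e : R)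
    (T : LpOQ -> LpOQ) :=
  [/\ linear T, forall u, `|T u| = `|u|, bijective T
    & forall (m : nat) (a : 'I_m -> Omega -> R)
        (b : 'I_m -> lebesgue_rV R n -> R) (u : LpOQ),
        (forall i, a i \in Lfun P p%:E) ->
        (forall i, b i \in Lfun (lebesgue_on oQ) p%:E) ->
        (u : _ -> R) = (fun z => \sum_(i < m) a i z.1 * b i z.2)
          %[ae (P \x lebesgue_on oQ)%E] ->
        (T u : _ -> R) =
          (fun z => \sum_(i < m) a i (tau (- (e^-1 *: z.2)) z.1) * b i z.2)
          %[ae (P \x lebesgue_on oQ)%E] ].

Definition lift_const (u : LpQ) : LpOQ := Lspace_class _ p1 (fun z => u z.2).

(* By Fubini, u(omega, .) is in L^p(Q) for almost every omega; Lspace_class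
   maps it to 0 for the other ones. *)
Definition at_omega (u : LpOQ) (w : Omega) : LpQ :=
  Lspace_class _ p1 (fun x => u (w, x)).

Definition averaged (E : Omega -> LpQ -> \bar R) (u : LpOQ) : \bar R :=
  (\int[P]_w E w (at_omega u w))%E.

Definition two_scale_cvg (T : R -> LpOQ -> LpOQ) (u : R -> LpOQ) (v : LpOQ) :=
  weak_cvg0 (fun e => T e (u e)) v.

(* The weak two-scale limits are restricted to functions that do not depend on
   omega, and the recovery family converges only in the two-scale sense. *)
Definition two_scale_gamma_cvg (T : R -> LpOQ -> LpOQ)
    (F : R -> LpOQ -> \bar R) (G : LpQ -> \bar R) :=
  (forall (u : LpQ) (v : R -> LpOQ), two_scale_cvg T v (lift_const u) ->
     (G u <= liminf0 (fun e => F e (v e)))%E) /\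
  (forall u : LpQ, exists2 v : R -> LpOQ, two_scale_cvg T v (lift_const u) &
     F e (v e) @[e --> 0^'+] --> G u).

End stochastic_unfolding.

Notation Lp_Q oQ p_gt1 := (LspaceType (lebesgue_on oQ) (lt1_le1e p_gt1)).
Notation Lp_OmegaQ P oQ p_gt1 :=
  (LspaceType (P \x lebesgue_on oQ)%E (lt1_le1e p_gt1)).

(* Main.v *)
Require Import Defs.
From HB Require Import structures.
From mathcomp Require Import all_boot all_order all_algebra.
From mathcomp Require Import all_classical all_reals all_analysis.
From mathcomp Require Import measurable_realfun ring lra.
Set Implicit Arguments.
Unset Strict Implicit.
Unset Printing Implicit Defensive.
Import Order.TTheory GRing.Theory Num.Theory.
Import numFieldNormedType.Exports.
Local Open Scope classical_set_scope.
Local Open Scope ring_scope.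

(* The hypotheses on [Ehom] are quenched, those on [Ehom'] are in mean; the two
   limits are compared by one inequality in each direction.

   [Ehom' <= Ehom]: a recovery sequence for [Ehom u] is needed that depends
   measurably on [w]. For small [e] the sets of all [(w, v)] with
   [E e w v <= Ehom u + delta] and [v] close to [u] project onto an event of
   probability close to 1, and a measurable selection of them is completed on
   the exceptional event by a selection of [E e w v <= psi w + 1]. Coercivity
   makes the selections integrable; they converge strongly to [u], hence in the
   two-scale sense, since unfolding is isometric and fixes deterministic
   functions.

   [Ehom <= Ehom']: minimizing [Ehom z + lam * |u - z|^p] yields a subgradient
   of [Ehom] at a point close to [u], namely a multiple of pairing with
   |g|^(p-2) g, where g = u - z. By compactness this affine minorant of [Ehom]
   is, up to [delta] and off an event of small probability, a minorant of
   [E e w]. Integrated along a two-scale convergent sequence it passes to the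
   limit: the pairing is the derivative of the p-th power of the norm at the
   deterministic function [g], and is therefore invariant under unfolding.

   The selections, and the measurability of the exceptional events, rest on the
   measurable projection theorem, obtained from Choquet's capacitability
   argument. *)

(** * Measurable projection and selection *)

Lemma measurable_least_index d (Omega : measurableType d)
    (D : nat -> set Omega) : (forall n, measurable (D n)) ->
  exists N : Omega -> nat, (forall n, measurable [set w | N w = n]) /\
    forall w n, D n w -> D (N w) w.
Proof.
move=> mD; pose N w := if pselect (exists n, `[< D n w >]) is left h
  then ex_minn h else 0%N.
exists N; split => [n|w n Dnw]; last first.
  rewrite /N; case: pselect => [h|[]]; first by case: ex_minnP => m /asboolP.
  by exists n; exact/asboolP.
pose L := D n `&` \bigcap_(m in [set m | (m < n)%N]) ~` D m.
pose O := if n == 0%N then \bigcap_m ~` D m else set0.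
have mL : measurable L.
  apply: measurableI => //; apply: bigcap_measurableType => m _.
  exact: measurableC.
have mO : measurable O.
  rewrite /O; case: ifP => // _.
  by apply: bigcapT_measurable => m; exact: measurableC.
rewrite (_ : [set w | _] = L `|` O); first exact: measurableU.
apply/seteqP; split => w; rewrite /L/O/= /N; case: pselect => /= [h|h].
- case: ex_minnP => m /asboolP dm mmin <-; left; split => // k /= km dk.
  by have := mmin k (asboolT dk); rewrite leqNgt km.
- move=> <-; right => // m _ dm; apply: h; exists m; exact/asboolP.
- case=> [[dn dlt]|]; last first.
    have [m /asboolP dm] := h; case: eqP => // _ dN; have := dN m I; exact.
  case: ex_minnP => m /asboolP dm mmin; apply/eqP.
  rewrite eqn_leq mmin ?andTb; last exact/asboolP.
  by rewrite leqNgt; apply/negP => /dlt; exact.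
- case=> [[dn _]|]; first by exfalso; apply: h; exists n; exact/asboolP.
  by case: eqP.
Qed.

Section outer_gt.
Context (R : realType) d (Omega : measurableType d) (P : probability Omega R).
Implicit Types (B M : set Omega) (c : \bar R).

(** Outer probability greater than [c], expressed through measurable covers; a measurable hull
    attains the infimum over covers, so strictness survives. *)
Definition outer_gt c B := forall M, measurable M -> B `<=` M -> (c < P M)%E.

Lemma outer_gtS c B B' : B `<=` B' -> outer_gt c B -> outer_gt c B'.
Proof. by move=> BB' cB M mM B'M; apply: cB => //; exact: subset_trans B'M. Qed.

(** Outer measure is continuous from below: if each [B m] had a cover [M m] of measure at most [c],
    the increasing sets [I n] would still cover the [B n], and their union would have measure at
    most [c]. *)
Lemma outer_gt_bigcup c (B : nat -> set Omega) :
  {homo B : m n / (m <= n)%N >-> m `<=` n} ->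
  outer_gt c (\bigcup_m B m) -> exists m, outer_gt c (B m).
Proof.
move=> Bnd cB; apply: contrapT => /forallNP Bc.
have /choice[M hM] m : exists M, [/\ measurable M, B m `<=` M & (P M <= c)%E].
  have /existsNP[M] := Bc m; move=> /not_implyP[mM] /not_implyP[BM] /negP.
  by rewrite -leNgt => Mc; exists M.
have mM m : measurable (M m) by have [] := hM m.
pose I n := \bigcap_(k in [set k | (n <= k)%N]) M k.
have mI n : measurable (I n) by exact: bigcap_measurableType.
have ndI : nondecreasing_seq I.
  move=> m n mn; apply/subsetPset => w Imw k /= nk; apply: Imw => /=.
  exact: leq_trans nk.
have : (c < P (\bigcup_n I n))%E.
  apply: cB; first exact: bigcupT_measurable.
  move=> w [m _ Bmw]; exists m => // k /= mk.
  by have [_ + _] := hM k; apply; exact: Bnd Bmw.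
apply/negP; rewrite -leNgt.
have cvgI := nondecreasing_cvg_mu (mu := P) mI (bigcupT_measurable _ mI) ndI.
rewrite -(cvg_lim _ cvgI)//; apply: lime_le; first by apply/cvg_ex; eexists;
  exact: cvgI.
apply: nearW => n; have [_ _] := hM n; apply: le_trans.
by apply: le_measure; rewrite ?inE// => w; apply => /=.
Qed.

End outer_gt.

(** * Measurable selection of branches in random trees *)

Section tree_selection.
Context (R : realType) d (Omega : measurableType d) (P : probability Omega R).
Variable T : Omega -> set (seq nat).
Hypothesis mT : forall s, measurable [set w | T w s].
Hypothesis Tprefix : forall w s t, T w (s ++ t) -> T w s.

Definition branch w (sigma : nat -> nat) := forall k, T w (mkseq sigma k).

Let bounded_branch w (t : seq nat) := exists2 sigma, branch w sigma &
  forall i, (i < size t)%N -> (sigma i <= nth 0%N t i)%N.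

(** Every branch respects the bound on its next entry once [m] is large, so continuity from below of
    the outer measure provides a suitable [m]. *)
Let bounded_branch_rcons c t : outer_gt P c [set w | bounded_branch w t] ->
  exists m, outer_gt P c [set w | bounded_branch w (rcons t m)].
Proof.
move=> ct; apply: outer_gt_bigcup => [m n mn w [sigma bs st]|].
  exists sigma => // i; rewrite size_rcons => it.
  apply: (leq_trans (st i _)); first by rewrite size_rcons.
  by rewrite !nth_rcons; case: ifP => // _; case: ifP.
apply: outer_gtS ct => w [sigma bs st]; exists (sigma (size t)) => //.
exists sigma => // i; rewrite size_rcons ltnS leq_eqVlt nth_rcons.
by case: ltngtP => //= [it _|-> _]; [exact: st|].
Qed.

Section bounded.
Variable tau : nat -> nat.

Let below (s : seq nat) := forall i, (i < size s)%N -> (nth 0%N s i <= tau i)%N.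

(** By Koenig's lemma this amounts to a branch through [s] bounded by [tau]; it involves countably
    many nodes only, hence is measurable in [w]. *)
Let deep w s :=
  forall k, exists2 t, size t = k & T w (s ++ t) /\ below (s ++ t).

Let measurable_prop_and (Q : Prop) (A : set Omega) : measurable A ->
  measurable [set w | A w /\ Q].
Proof.
move=> mA; have [q|q] := pselect Q.
  by rewrite (_ : [set w | _] = A)//; apply/seteqP; split=> // w [].
by rewrite (_ : [set w | _] = set0)//; apply/seteqP; split=> // w [].
Qed.

Let measurable_deep s : measurable [set w | deep w s].
Proof.
rewrite (_ : [set w | _] = \bigcap_k \bigcup_(t : seq nat)
    [set w | [set w | T w (s ++ t)] w /\ (size t = k /\ below (s ++ t))]).
  apply: bigcapT_measurable => k.
  by apply: countable_bigcupT_measurable => // t; exact: measurable_prop_and.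
apply/seteqP; split => [w ws k _|w ws k].
  by have [t tk [? ?]] := ws k; exists t.
by have [t _ [? []]] := ws k I; exists t.
Qed.

Let deep_rcons w s : deep w s -> exists n, deep w (rcons s n).
Proof.
move=> ws; apply: contrapT => /forallNP h.
have /choice[K hK] n : exists k, ~ exists2 t, size t = k &
    T w (rcons s n ++ t) /\ below (rcons s n ++ t).
  by have /existsNP[k] := h n; exists k.
(* The children allowed by [tau] are finitely many. If each child [n] fails at some depth [K n], an
   extension longer than all these depths contradicts the failure of its own first entry. *)
have [[//|n t] [tK] [Tst bst]] := ws (\max_(n < (tau (size s)).+1) K n).+1.
have ntau : (n < (tau (size s)).+1)%N.
  have := bst (size s); rewrite size_cat/= nth_cat ltnn subnn/= ltnS; apply.
  by rewrite -addSnnS leq_addr.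
have Kn : (K n <= size t)%N.
  by rewrite tK (leq_bigmax (F := fun n : 'I__ => K n) (Ordinal ntau)).
apply: (hK n); exists (take (K n) t); first by rewrite size_takel.
have E : s ++ n :: t = (rcons s n ++ take (K n) t) ++ drop (K n) t.
  by rewrite -catA cat_take_drop cat_rcons.
rewrite {}E in Tst bst; split; first exact: Tprefix Tst.
move=> i it; have := bst i; rewrite nth_cat it; apply.
by rewrite size_cat ltn_addr.
Qed.

Let next_sig : {next : seq nat -> Omega -> nat & forall s,
  (forall n, measurable [set w | next s w = n]) /\
  forall w, deep w s -> deep w (rcons s (next s w))}.
Proof.
apply: (@choice _ _ (fun s (f : Omega -> nat) =>
  (forall n, measurable [set w | f w = n]) /\
  forall w, deep w s -> deep w (rcons s (f w)))) => s.
have [N [mN hN]] := @measurable_least_index _ Omega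
  (fun n => [set w | deep w (rcons s n)]) (fun n => measurable_deep _).
by exists N; split => // w /deep_rcons[n]; exact: hN.
Qed.

Let next := projT1 next_sig.

Let measurable_next s n : measurable [set w | next s w = n].
Proof. exact: (projT2 next_sig s).1. Qed.

Let next_deep w s : deep w s -> deep w (rcons s (next s w)).
Proof. exact: (projT2 next_sig s).2. Qed.

Let leftmost (w : Omega) := fix leftmost (k : nat) : seq nat :=
  if k is k'.+1 then rcons (leftmost k') (next (leftmost k') w) else [::].

Let measurable_leftmost k s : measurable [set w | leftmost w k = s].
Proof.
elim: k s => [|k IH] s.
  by have := @measurable_prop_and ([::] = s) _ measurableT;
    congr measurable; apply/seteqP; split => w //= [].
rewrite (_ : [set w | _] = \bigcup_(t : seq nat) \bigcup_n
    [set w | ([set w | leftmost w k = t] `&` [set w | next t w = n]) w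
             /\ rcons t n = s]).
  apply: countable_bigcupT_measurable => // t; apply: bigcupT_measurable => n.
  by apply: measurable_prop_and; exact: measurableI.
apply/seteqP; split => [w /= ws|w [t _ [n _ [[/= <- <-] //]]]].
by exists (leftmost w k) => //; exists (next (leftmost w k) w).
Qed.

(** The branch is built greedily through deep nodes. The event of a deep root is the decreasing
    limit of the events that some node of length [k] below [tau] is present; these have probability
    above [c], which leaves [c <=] in the limit. *)
Lemma bounded_tree_selection (c : \bar R) :
  (forall k, outer_gt P c [set w | bounded_branch w (mkseq tau k)]) ->
  exists (S : set Omega) (sigma : Omega -> nat -> nat),
    [/\ measurable S, (c <= P S)%E, forall w, S w -> branch w (sigma w)
      & forall k m, measurable [set w | sigma w k = m]].
Proof.
move=> ctau; exists [set w | deep w [::]], (fun w k => next (leftmost w k) w).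
split.
- exact: measurable_deep.
- pose S k := \bigcup_(t : seq nat)
    [set w | [set w | T w t] w /\ (size t = k /\ below t)].
  have mS k : measurable (S k).
    by apply: countable_bigcupT_measurable => // t; exact: measurable_prop_and.
  have -> : [set w | deep w [::]] = \bigcap_k S k.
    apply/seteqP; split => [w dw k _|w dw k].
      by have [t /= tk [Tt bt]] := dw k; exists t.
    by have [t _ [Tt [tk bt]]] := dw k I; exists t.
  have niS : nonincreasing_seq S.
    apply/nonincreasing_seqP => k; apply/subsetPset => w [t _ [/= Tt [tk bt]]].
    exists (take k t) => //=; split.
      by apply: (@Tprefix _ _ (drop k t)); rewrite cat_take_drop.
    have stk : size (take k t) = k by rewrite size_takel// tk.
    split => // i; rewrite stk => ik; rewrite nth_take//; apply: bt.
    by rewrite tk; exact: ltnW.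
  have S0y : (P (S 0%N) < +oo)%E by rewrite ltey_eq fin_num_measure.
  have cvgS := nonincreasing_cvg_mu
    (mu := P) S0y mS (bigcapT_measurable mS) niS.
  rewrite -(cvg_lim _ cvgS)//; apply: lime_ge.
    by apply/cvg_ex; eexists; exact: cvgS.
  apply: nearW => k; apply/ltW/(ctau k) => // w [sigma bs st].
  exists (mkseq sigma k) => //=; split; first exact: bs.
  rewrite size_mkseq; split => // i; rewrite size_mkseq => ik.
  by rewrite nth_mkseq//; have := st i; rewrite size_mkseq nth_mkseq//; exact.
- move=> w dw k.
  have -> : mkseq (fun k => next (leftmost w k) w) k = leftmost w k.
    by elim: k => // k IH; rewrite mkseqS IH.
  have dk : deep w (leftmost w k).
    by elim: k => [//|k IH] /=; exact: next_deep.
  by have [t _ []] := dk 0%N; move=> /Tprefix.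
- move=> k m; rewrite (_ : [set w | _] = \bigcup_(t : seq nat)
    ([set w | leftmost w k = t] `&` [set w | next t w = m])).
    by apply: countable_bigcupT_measurable => // t; exact: measurableI.
  apply/seteqP; split => [w /= wm|w [t _ [/= <- <-] //]].
  by exists (leftmost w k).
Qed.

End bounded.

(* Choquet's capacitability argument: the branches are successively bounded
   without decreasing the outer measure below [c]; bounded branches form a
   finitely branching tree, where Koenig's lemma applies. *)
Lemma tree_selection (c : \bar R) :
  outer_gt P c [set w | exists sigma, branch w sigma] ->
  exists (S : set Omega) (sigma : Omega -> nat -> nat),
    [/\ measurable S, (c <= P S)%E, forall w, S w -> branch w (sigma w)
      & forall k m, measurable [set w | sigma w k = m]].
Proof.
move=> cT; pose G t := outer_gt P c [set w | bounded_branch w t].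
have /choice[f hf] t : exists m, G t -> G (rcons t m).
  have [/bounded_branch_rcons[m Gm]|Gt] := pselect (G t); first by exists m.
  by exists 0%N.
pose ts := fix ts k := if k is k'.+1 then rcons (ts k') (f (ts k')) else [::].
apply: (@bounded_tree_selection (fun k => f (ts k))) => k.
have -> : mkseq (fun k => f (ts k)) k = ts k.
  by elim: k => // k IH; rewrite mkseqS IH.
elim: k => [|k IH] /=; last exact: hf.
by apply: outer_gtS cT => w [sigma bs]; exists sigma.
Qed.

End tree_selection.

Definition decode2 (m : nat) : nat * nat := odflt (0%N, 0%N) (unpickle m).

Lemma pickleK2 x : decode2 (pickle x) = x.
Proof. by rewrite /decode2 pickleK. Qed.

(** * Souslin sets in the product of sample space and normed space *)

Section souslin.
Context (R : realType) d (Omega : measurableType d) (V : normedModType R).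
Notation BV := (g_sigma_algebraType (@open V)).

(** Closedness in the Baire space of sequences, tested on initial segments. *)
Definition closed_seqs (Z : set (nat -> nat)) := forall sigma,
  (forall k, exists2 rho, Z rho & forall i, (i < k)%N -> rho i = sigma i) ->
  Z sigma.

(* Souslin's operation on rectangles with measurable first side and closed
   second side. Restricting the codes to a closed set [Z] makes the class stable
   under countable unions and intersections by mere recoding. *)
Definition souslin (A : set (Omega * V)) :=
  exists (Z : set (nat -> nat)) (U : nat -> nat -> set Omega)
    (F : nat -> nat -> set V),
  [/\ closed_seqs Z, forall k m, measurable (U k m), forall k m, closed (F k m)
    & A = [set z | exists2 sigma, Z sigma &
             forall k, U k (sigma k) z.1 /\ F k (sigma k) z.2]].

Lemma souslin_rect U F : measurable U -> closed F -> souslin (U `*` F).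
Proof.
move=> mU cF; exists setT, (fun _ _ => U), (fun _ _ => F); split => //.
apply/seteqP; split => [[w v] [/= Uw Fv]|[w v] [/= sigma _ /(_ 0%N)]//].
by exists (fun=> 0%N).
Qed.

Lemma souslin_bigcup (A : nat -> set (Omega * V)) :
  (forall j, souslin (A j)) -> souslin (\bigcup_j A j).
Proof.
move=> /choice[Z /choice[U /choice[F H]]].
pose fst2 (sigma : nat -> nat) k := (decode2 (sigma k)).1.
pose snd2 (sigma : nat -> nat) k := (decode2 (sigma k)).2.
(* Each entry of a code for the union carries the index [j] beside an entry of a code for [A j];
   constancy of [j] is visible on initial segments, so these codes form a closed set. *)
exists [set sigma | exists2 j, forall k, fst2 sigma k = j & Z j (snd2 sigma)],
  (fun k m => U (decode2 m).1 k (decode2 m).2),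
  (fun k m => F (decode2 m).1 k (decode2 m).2); split.
- move=> sigma h; exists (fst2 sigma 0%N) => [k|].
    have [rho [j jrho _] rs] := h k.+1.
    have E m : (m < k.+1)%N -> fst2 sigma m = j.
      by move=> mk; rewrite /fst2 -rs//; exact: jrho.
    by rewrite !E.
  have [cZ _ _ _] := H (fst2 sigma 0%N); apply: cZ => k.
  have [rho [j jrho Zrho] rs] := h k.+1.
  exists (snd2 rho) => [|i ik]; last by rewrite /snd2 rs// ltnW.
  by rewrite (_ : fst2 sigma 0%N = j)// /fst2 -rs//; exact: jrho.
- by move=> k m; have [_ + _ _] := H (decode2 m).1; exact.
- by move=> k m; have [_ _ + _] := H (decode2 m).1; exact.
apply/seteqP; split => [[w v] [j _]|[w v] [/= sigma [j sj Zj] UF]].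
  have [_ _ _ ->] := H j; move=> [/= sigma Zs UF].
  exists (fun k => pickle (j, sigma k)) => /= [|k]; last by rewrite pickleK2.
  exists j => [k|]; first by rewrite /fst2 pickleK2.
  by congr (Z j): Zs; apply/funext => k; rewrite /snd2 pickleK2.
exists j => //; have [_ _ _ ->] := H j; exists (snd2 sigma) => //= k.
by have := UF k; rewrite -!/(fst2 _ _) !sj.
Qed.

Lemma souslin_bigcap (A : nat -> set (Omega * V)) :
  (forall j, souslin (A j)) -> souslin (\bigcap_j A j).
Proof.
move=> /choice[Z /choice[U /choice[F H]]].
(* A code for the intersection interleaves one code for each [A j], row [j] occupying the positions
   [pickle (j, k)]. *)
exists [set sigma | forall j, Z j (fun k => sigma (pickle (j, k)))],
  (fun n => U (decode2 n).1 (decode2 n).2),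
  (fun n => F (decode2 n).1 (decode2 n).2); split.
- move=> sigma h j; have [cZ _ _ _] := H j; apply: cZ => k.
  have [rho Zrho rs] := h (\max_(i < k) pickle (j, nat_of_ord i)).+1.
  exists (fun k => rho (pickle (j, k))) => // i ik; apply: rs; rewrite ltnS.
  by rewrite (leq_bigmax (F :=
    fun i : 'I_k => pickle (j, nat_of_ord i)) (Ordinal ik)).
- by move=> n m; have [_ + _ _] := H (decode2 n).1; exact.
- by move=> n m; have [_ _ + _] := H (decode2 n).1; exact.
apply/seteqP; split => [[w v] Awv|[w v] [/= sigma Zs UF] j _]; last first.
  have [_ _ _ ->] := H j; exists (fun k => sigma (pickle (j, k))) => //= k.
  by have := UF (pickle (j, k)); rewrite pickleK2.
have /choice[s hs] j : exists sigma, Z j sigma /\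
    forall k, U j k (sigma k) w /\ F j k (sigma k) v.
  by have := Awv j I; have [_ _ _ ->] := H j; move=> [sigma]; exists sigma.
exists (fun n => s (decode2 n).1 (decode2 n).2) => /= [j|n].
  by have [+ _] := hs j; congr (Z j); apply/funext => k; rewrite pickleK2.
exact: (hs _).2.
Qed.

Lemma open_Fsigma (G : set V) : open G ->
  exists F : nat -> set V, (forall n, closed (F n)) /\ G = \bigcup_n F n.
Proof.
move=> oG; pose F n := [set x : V | ball x n.+1%:R^-1 `<=` G].
exists F; split => [n x Fx y xy|].
  have [z [Fz]] : F n `&` ball y n.+1%:R^-1 !=set0.
    apply: Fx; rewrite nbhs_ballP.
    have /open_nbhs_nbhs := (conj (ball_open y (n.+1%:R^-1 : R)) (ball_sym xy)).
    by move=> /nbhs_ballP.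
  by move=> /ball_sym; exact: Fz.
apply/seteqP; split => [x Gx|x [n _]]; last first.
  by apply; exact: ballxx.
have /nbhs_ballP[e /= e0 xeG] : nbhs x G by exact: open_nbhs_nbhs.
have [n ne] := ltr_add_invr e0.
exists n => // y xy; apply: xeG; apply: le_ball xy; apply: ltW.
by rewrite -[ltLHS]add0r.
Qed.

Let bisouslin A := souslin A /\ souslin (~` A).

Let sigma_algebra_bisouslin : sigma_algebra setT bisouslin.
Proof.
split.
- split; last by rewrite setC0 -setXTT; apply: souslin_rect => //;
    exact: closedT.
  rewrite (_ : set0 = (set0 : set Omega) `*` (set0 : set V));
    last by rewrite setX0.
  by apply: souslin_rect => //; exact: closed0.
- by move=> A [sA sCA]; rewrite setTD; split => //; rewrite setCK.
- move=> A sA; split; first by apply: souslin_bigcup => j; exact: (sA j).1.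
  by rewrite setC_bigcup; apply: souslin_bigcap => j; exact: (sA j).2.
Qed.

(** The sets that are Souslin together with their complement form a sigma-algebra. It contains the
    generating cylinders, since an open set is a countable union of closed ones. *)
Lemma measurable_souslin (A : set (Omega * BV)) :
  measurable A -> souslin (A : set (Omega * V)).
Proof.
move=> mA; suff /(_ _ mA)[] :
    @measurable _ (Omega * BV)%type `<=`
      (bisouslin : set (set (Omega * BV))) by [].
apply: smallest_sub => // _ [[U mU <-]|[B mB <-]].
  rewrite setTI (_ : fst @^-1` U = U `*` setT); last first.
    by apply/seteqP; split => [[w v]//|[w v] []].
  split; first exact: souslin_rect _ closedT.
  rewrite (_ : ~` _ = (~` U) `*` setT); last first.
    by apply/seteqP; split => [[w v]/= h|[w v] [/= h _] [//]]; split => // Uw;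
      exact: h.
  by apply: souslin_rect; [exact: measurableC|exact: closedT].
suff : @measurable _ BV `<=`
    [set B : set BV | bisouslin (setT `&` snd @^-1` B)].
  exact.
apply: smallest_sub.
  split => /=.
  - by rewrite setTI preimage_set0; case: sigma_algebra_bisouslin.
  - move=> C; rewrite setTD !setTI preimage_setC -setTD.
    by case: sigma_algebra_bisouslin => _ + _; exact.
  - move=> C mC; rewrite setTI preimage_bigcup.
    case: sigma_algebra_bisouslin => _ _; apply => n.
    by have := mC n; rewrite /= setTI.
move=> G oG /=; rewrite setTI.
have [F [cF GF]] := open_Fsigma oG.
split.
  rewrite (_ : _ @^-1` G = \bigcup_n (setT `*` F n)); last first.
    rewrite GF; apply/seteqP; split => [[w v] [n _ Fv]|[w v] [n _ [_ Fv]]];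
    by exists n.
  by apply: souslin_bigcup => n; exact: souslin_rect.
rewrite (_ : ~` _ = setT `*` ~` G); last first.
  by apply/seteqP; split => [[w v] Gv|[w v] [_ Gv]].
by apply: souslin_rect => //; exact: open_closedC.
Qed.

Lemma compact_net (K : set V) (r : R) : compact K -> 0 < r ->
  exists e : nat -> V, forall x, K x -> exists m, `|x - e m| <= r.
Proof.
rewrite compact_cover => cK r0.
have [|D _ KD] := cK V K (fun x => ball x r) (fun _ _ => ball_open _ _).
  by move=> x Kx; exists x => //; exact: ballxx.
exists (fun m => nth 0 (finmap.enum_fset D) m) => x /KD[y /= yD xy].
exists (index y (finmap.enum_fset D)); rewrite nth_index// distrC ltW//.
by move: xy; rewrite -ball_normE.
Qed.

End souslin.

(** Stands in for the extraction of convergent subsequences: the cluster point is approached at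
    arbitrarily late indices. *)
Lemma compact_cluster_seq (V : topologicalType) (K : set V) (x : nat -> V) :
  compact K -> (forall k, K (x k)) ->
  exists2 y, K y & forall B, nbhs y B -> forall n, exists2 k,
    (n <= k)%N & B (x k).
Proof.
move=> cK Kx; have [|y [Ky yx]] := cK (x k @[k --> \oo]) _.
  by exists 0%N => // k _; exact: Kx.
exists y => // B yB n.
have [_ [[k nk <-] Bk]] : (x @` [set k | (n <= k)%N]) `&` B !=set0.
  by apply: yx => //; exists n => // k nk; exists k.
by exists k.
Qed.

Section selection.
Context (R : realType) d (Omega : measurableType d) (P : probability Omega R).
Context (V : normedModType R).
Notation BV := (g_sigma_algebraType (@open V)).
Implicit Types (S : set Omega) (v : Omega -> V) (A : set (Omega * V)).

(* Strong measurability on [S]. *)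
Definition approximable S v := forall r : R, 0 < r ->
  exists (e : nat -> V) (i : Omega -> nat),
    (forall m, measurable [set w | i w = m]) /\
    forall w, S w -> `|v w - e (i w)| <= r.

(** The pieces are glued along the least [n] with [w] in [S n]; packing [n] with the index of the
    approximating value keeps the approximants countably valued. *)
Lemma approximable_bigcup (S : nat -> set Omega) (v : nat -> Omega -> V) :
  (forall n, measurable (S n)) -> (forall n, approximable (S n) (v n)) ->
  exists2 u, approximable (\bigcup_n S n) u &
    forall w, (\bigcup_n S n) w -> exists2 n, S n w & u w = v n w.
Proof.
move=> mS Sv; have [N [mN SN]] := measurable_least_index mS.
exists (fun w => v (N w) w) => [r r0|w [n _ Snw]]; last first.
  by exists (N w) => //; exact: SN Snw.
have /choice[e /choice[i H]] n := Sv n r r0.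
exists (fun m => e (decode2 m).1 (decode2 m).2),
  (fun w => pickle (N w, i (N w) w)); split => [m|w [n _ Snw]]; last first.
  by rewrite pickleK2; apply: (H _).2; exact: SN Snw.
rewrite (_ : [set w | _] = \bigcup_n \bigcup_k
    if pickle (n, k) == m then [set w | N w = n] `&` [set w | i n w = k]
    else set0).
  apply: bigcupT_measurable => n; apply: bigcupT_measurable => k.
  by case: ifP => // _; apply: measurableI => //; exact: (H n).1.
apply/seteqP; split => [w /= <-|w [n _ [k _]]].
  by exists (N w) => //; exists (i (N w) w) => //; rewrite eqxx.
by case: eqP => // <- [/= <- <-].
Qed.

(** A node records an initial segment of a Souslin code and, for each [i], the number of a net point
    within 2^-i of the sought point. Along a branch compactness supplies the point, and the net
    numbers give measurable approximations of it. *)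
Lemma souslin_selection A (K : set V) (c : \bar R) : souslin A -> compact K ->
  (forall z, A z -> K z.2) -> outer_gt P c (fst @` A) ->
  exists S v, [/\ measurable S, (c <= P S)%E, forall w, S w -> A (w, v w)
    & approximable S v].
Proof.
move=> [Z [U [F [cZ mU cF AE]]]] cK AK cA.
pose r k : R := (2 ^- k); have r0 k : 0 < r k by rewrite /r invr_gt0 exprn_gt0.
have /choice[e he] k := compact_net cK (r0 k).
pose D s k := decode2 (nth 0%N s k).
pose seqok s := exists2 sigma, Z sigma &
  forall i, (i < size s)%N -> sigma i = (D s i).1.
pose ptok s x := K x /\ forall i, (i < size s)%N ->
  F i (D s i).1 x /\ `|x - e i (D s i).2| <= r i.
(* The sample enters only through the sets [U]; the existence of a code and of a point depends on
   the node alone, whence measurability. *)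
pose T w s := (seqok s /\ exists x, ptok s x) /\
  forall i, (i < size s)%N -> U i (D s i).1 w.
have mT s : measurable [set w | T w s].
  have mI : measurable (\bigcap_(i in [set i | (i < size s)%N]) U i (D s i).1).
    exact: bigcap_measurableType.
  have [q|q] := pselect (seqok s /\ exists x, ptok s x).
    by congr measurable: mI; apply/seteqP; split => [w h|w []].
  by rewrite (_ : [set w | _] = set0)//; apply/seteqP; split=> // w [].
have Tprefix w s t : T w (s ++ t) -> T w s.
  have E i : (i < size s)%N -> D (s ++ t) i = D s i.
    by move=> si; rewrite /D nth_cat si.
  have L i : (i < size s)%N -> (i < size (s ++ t))%N.
    by move=> si; rewrite size_cat ltn_addr.
  move=> [[[sigma Zs hs] [x [Kx hx]]] hU]; split; first split.
  - by exists sigma => // i si; rewrite hs ?L// E.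
  - by exists x; split => // i si; rewrite -E//; apply: hx; exact: L.
  - by move=> i si; rewrite -E//; apply: hU; exact: L.
have Dmk tau k i : (i < k)%N -> D (mkseq tau k) i = decode2 (tau i).
  by move=> ik; rewrite /D nth_mkseq.
have cT : outer_gt P c [set w | exists tau, branch T w tau].
  apply: outer_gtS cA => _ [[w x] Awx <-] /=; have Kx := AK _ Awx.
  move: Awx; rewrite AE => -[/= sigma Zs hs].
  have /choice[b hb] i := he i x Kx.
  exists (fun i => pickle (sigma i, b i)) => k; split; first split.
  - by exists sigma => // i; rewrite size_mkseq => ik; rewrite Dmk// pickleK2.
  - exists x; split => // i; rewrite size_mkseq => ik; rewrite Dmk// pickleK2.
    by split => //; exact: (hs i).2.
  - move=> i; rewrite size_mkseq => ik; rewrite Dmk// pickleK2.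
    exact: (hs i).1.
have [S [tau [mS cS tauS mtau]]] := tree_selection mT Tprefix cT.
have point w : exists x, S w ->
    A (w, x) /\ forall i, `|x - e i (decode2 (tau w i)).2| <= r i.
  have [Sw|] := pselect (S w); last by exists 0.
  have /choice[x hx] k : exists x, ptok (mkseq (tau w) k) x.
    by have [[_ ?] _] := tauS _ Sw k.
  (* [x k] meets the first [k] constraints on the point; each is closed, so a cluster point meets
     them all. *)
  have [y Ky yx] := compact_cluster_seq cK (fun k => (hx k).1).
  have xy (G : set V) i : closed G -> (forall k, (i < k)%N -> G (x k)) -> G y.
    move=> cG Gx; apply: cG => B /yx/(_ i.+1)[k ik Bk].
    by exists (x k); split => //; exact: Gx.
  exists y => _; split=> [|i]; last first.
    apply: (xy [set z | `|z - e i (decode2 (tau w i)).2| <= r i] i).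
      rewrite (_ : [set z | _] = closed_ball (e i (decode2 (tau w i)).2) (r i)).
        exact: closed_ball_closed.
      by rewrite closed_ballE//; apply/seteqP; split => z /=;
        rewrite /closed_ball_/= distrC.
    move=> k ik; have [_] := hx k; rewrite size_mkseq => /(_ i ik)[_].
    by rewrite Dmk.
  rewrite AE; exists (fun i => (decode2 (tau w i)).1) => [|i /=].
    apply: cZ => k; have [[[sigma Zs hs] _] _] := tauS w Sw k.
    by exists sigma => // i ik; rewrite hs ?size_mkseq// Dmk.
  split.
    have [_] := tauS w Sw i.+1; rewrite size_mkseq => /(_ i (ltnSn i)).
    by rewrite Dmk.
  apply: (xy _ i) => // k ik; have [_] := hx k; rewrite size_mkseq.
  by move=> /(_ i ik)[+ _]; rewrite Dmk.
have [v hv] := choice point; exists S, v; split => // [w /hv[]//|s s0].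
have [k ks] : exists k, r k <= s.
  have [k ks] := ltr_add_invr s0; exists k; rewrite add0r in ks.
  apply: le_trans (ltW ks); rewrite /r lef_pV2 ?posrE ?exprn_gt0//.
  by rewrite -natrX ler_nat ltn_expl.
exists (fun m => e k (decode2 m).2), (fun w => tau w k); split => [m//|w Sw].
exact: le_trans ((hv w Sw).2 k) ks.
Qed.

(* Measurable projection and Jankov-von Neumann selection; as [P] need not be
   complete, the projection of [A] is only measurable up to the null set [N]. *)
Lemma measurable_selection (A : set (Omega * BV)) (K : nat -> set V) :
  measurable A -> (forall j, compact (K j)) ->
  (forall z, A z -> (\bigcup_j K j) z.2) ->
  exists S (N : set Omega) v, [/\ measurable S, measurable N /\ P N = 0%E,
    fst @` A `<=` S `|` N, forall w, S w -> A (w, v w) & approximable S v].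
Proof.
move=> mA cK AK; pose B j : set (Omega * V) := A `&` (setT `*` K j).
have sB j : souslin (B j).
  rewrite (_ : B j = \bigcap_n if n is 0%N then A else setT `*` K j).
    apply: souslin_bigcap => -[|n]; first exact: measurable_souslin.
    by apply: souslin_rect => //; apply: compact_closed => //;
      exact: norm_hausdorff.
  by apply/seteqP; split => [z [Az Kz] [|n] _//|z h]; split;
    [exact: h 0%N I|exact: h 1%N I].
have step j k : exists M S v, [/\ measurable M /\ fst @` B j `<=` M,
    measurable S, (forall w, S w -> B j (w, v w)), approximable S v
    & (P (M `\` S) <= k.+1%:R^-1%:E)%E].
  pose cov := [set P M | M in [set M | measurable M /\ fst @` B j `<=` M]].
  have cov0 : cov !=set0 by exists (P setT); exists setT.
  pose c := ereal_inf cov.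
  have c0 : (0 <= c)%E by apply: le_ereal_inf_tmp => _ [M _ <-].
  have c1 : (c <= 1)%E.
    by rewrite -(probability_setT P); apply: ereal_inf_lbound; exists setT.
  have cfin : c \is a fin_num.
    by rewrite ge0_fin_numE// (le_lt_trans c1)// ltry.
  (* Half of the tolerance: the cover [M] exceeds the outer measure [c] by at most [r], and the
     selected set [S] falls short of it by at most [r]. *)
  pose r : R := k.+1%:R^-1 / 2.
  have r0 : 0 < r by rewrite divr_gt0// invr_gt0.
  have [_ [M [mM BM] <-] Mc] := lb_ereal_inf_adherent r0 cfin.
  have cB : outer_gt P (c - r%:E)%E (fst @` B j).
    move=> M' mM' BM'; apply: (@lt_le_trans _ _ c).
      by rewrite lteBlDr// lteDl.
    by apply: ereal_inf_lbound; exists M'.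
  have [S [v [mS cS Sv aS]]] := @souslin_selection _ (K j) _ (sB j) (cK j)
    (fun z Bz => Bz.2.2) cB.
  exists M, S, v; split => //.
  have SM : S `<=` M by move=> w /Sv Bw; apply: BM; exists (w, v w).
  have PSfin : P S \is a fin_num by exact: fin_num_measure.
  rewrite measureD//; last by rewrite ltey_eq fin_num_measure.
  rewrite (setIidr SM).
  apply: (@le_trans _ _ ((c + r%:E) - (c - r%:E))%E).
    by apply: leeB => //; exact: ltW.
  rewrite -(fineK cfin); set g := fine c.
  rewrite (_ : _ - _ = (g + r - (g - r))%:E)%E// lee_fin opprB addrC addrA.
  by rewrite subrK -splitr.
have /choice[M /choice[S /choice[v H]]] (n : nat) : exists M S v,
    [/\ measurable M /\ fst @` B (decode2 n).1 `<=` M, measurable S,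
    (forall w, S w -> B (decode2 n).1 (w, v w)), approximable S v
    & (P (M `\` S) <= (decode2 n).2.+1%:R^-1%:E)%E] by exact: step.
have mM n : measurable (M n) by have [[]] := H n.
have mS n : measurable (S n) by have [] := H n.
(* A point of the projection of [B j] caught by no [S n] lies, for every [k], in a difference of
   measure at most 1/(k+1). *)
pose N (j : nat) := \bigcap_(k : nat) (M (pickle (j, k)) `\` S (pickle (j, k))).
have mN j : measurable (N j) by apply: bigcapT_measurable => k;
  exact: measurableD.
have N0 j : P (N j) = 0%E.
  apply/eqP; rewrite -measure_le0; apply/lee_addgt0Pr => e e0; rewrite add0e.
  have [k ke] := ltr_add_invr e0; rewrite add0r in ke.
  apply: (@le_trans _ _ (k.+1%:R^-1)%:E); last by rewrite lee_fin ltW.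
  have [_ _ _ _] := H (pickle (j, k)); rewrite pickleK2 /=; apply: le_trans.
  by apply: le_measure; rewrite ?inE//; [exact: measurableD|move=> w; apply].
have [u au uv] := approximable_bigcup mS (fun n => let: And5 _ _ _ aS _ :=
  H n in aS).
exists (\bigcup_n S n), (\bigcup_j N j), u; split => //.
- exact: bigcupT_measurable.
- have mN' : measurable (\bigcup_j N j) by exact: bigcupT_measurable.
  split => //; apply/(negligibleP P mN').
  by apply: negligible_bigcup => j; apply/(negligibleP P (mN j)); exact: N0.
- move=> w [[w' x] Awx /= <-];
    have [[n _ Sn]|nS] := pselect ((\bigcup_n S n) w').
    by left; exists n.
  right; have [j _ Kj] := AK _ Awx; exists j => // k _; split.
    have [[_ +] _ _ _ _] := H (pickle (j, k)); rewrite pickleK2; apply.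
    by exists (w', x).
  by move=> Sw; apply: nS; exists (pickle (j, k)).
- move=> w /uv[n Snw ->]; have [_ _ + _ _] := H n.
  by move=> /(_ _ Snw)[].
Qed.

End selection.

(** * Spaces L^p and their sections *)

Section Lspace_norm.
Context d (T : measurableType d) (R : realType).
Variables (mu : {measure set T -> \bar R}) (p : R) (p1 : (1 <= p%:E)%E).
Notation L := (LspaceType mu p1).
Implicit Types (u v : L) (f : T -> R).

Let p_ge1 : 1 <= p. Proof. by rewrite -lee_fin. Qed.
Let p_gt0 : 0 < p. Proof. exact: lt_le_trans ltr01 p_ge1. Qed.
Let p_neq0 : p != 0. Proof. exact: lt0r_neq0. Qed.

Lemma measurable_normX f : measurable_fun setT f ->
  measurable_fun setT (fun x => `|f x| `^ p).
Proof.
move=> mf; apply: (measurableT_comp (measurable_powR p)).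
exact: measurableT_comp.
Qed.

Lemma measurable_normXE f : measurable_fun setT f ->
  measurable_fun setT (fun x => (`|f x| `^ p)%:E).
Proof. by move=> mf; apply/measurable_EFinP; exact: measurable_normX. Qed.

Lemma LfunE f : measurable_fun setT f ->
  (\int[mu]_x (`|f x| `^ p)%:E < +oo)%E -> f \in Lfun mu p%:E.
Proof.
move=> mf foo; rewrite inE; apply/andP; split; rewrite inE//=.
rewrite /finite_norm unlock.
exact: poweR_lty.
Qed.

Lemma Lspace_normX u : (`|u| `^ p)%:E = (\int[mu]_x (`|u x| `^ p)%:E)%E.
Proof.
have := Lspace_Lfun u => /[dup] /sub_Lfun_finLfun;
  rewrite inE/= /finite_norm => foo _.
rewrite -[RHS](powR_Lnorm mu (EFin \o (u : T -> R)))// Lspace_normE.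
rewrite -[in RHS](@fineK _ ('N[mu]_p%:E[EFin \o (u : T -> R)])%E).
  by rewrite poweR_EFin.
by rewrite ge0_fin_numE ?Lnorm_ge0.
Qed.

Lemma LspaceBE u v : ((u - v : L) : T -> R) = (u : T -> R) \- v %[ae mu].
Proof.
pose w : L := (-1) *: v.
have := LspaceDE u w; have := LspaceZE (-1) v; rewrite -/w.
rewrite (_ : u + w = u - v); last by rewrite /w scaleN1r.
apply: filterS2 => x /(_ I) h1 /(_ I) -> _ /=; rewrite h1/=.
by rewrite scaleN1r.
Qed.

(** The rate makes the integrals of |u_k - u|^p summable, so the series of the integrands is finite
    almost everywhere and its terms vanish. *)
Lemma Lspace_ae_cvg (u_ : nat -> L) u :
  (forall k, `|u_ k - u| <= (2 ^ k.+1)%:R^-1) ->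
  {ae mu, forall x, u_ k x @[k --> \oo] --> u x}.
Proof.
move=> uu; pose D k : L := u_ k - u.
pose F x := (\sum_(k <oo) (`|D k x| `^ p)%:E)%E.
have D0 k x : (0 <= (`|D k x| `^ p)%:E)%E by rewrite lee_fin powR_ge0.
have mD k : measurable_fun setT (fun x => (`|D k x| `^ p)%:E).
  by apply: measurable_normXE; exact: Lspace_measurable.
have mF : measurable_fun setT F by exact: ge0_emeasurable_sum.
have F0 x : (0 <= F x)%E by exact: nneseries_ge0.
have Foo : (\int[mu]_x F x < +oo)%E.
  rewrite integral_nneseries//; apply: (@le_lt_trans _ _ 1%:E);
    last exact: ltry.
  apply: (le_trans _ (epsilon_trick0 xpredT ler01)).
  apply: lee_nneseries => k _; first by move=> _; exact: integral_ge0.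
  rewrite -Lspace_normX lee_fin; have Dk := uu k.
  rewrite div1r; apply: le_trans (Dk); have [->|Dk0] := eqVneq (D k) 0.
    by rewrite normr0 powR0.
  apply: ge1r_powR => //; rewrite normr_gt0 Dk0/=; apply: (le_trans Dk).
  by rewrite invf_le1// ler1n expn_gt0.
have /integrable_ae iF : mu.-integrable setT F.
  apply/integrableP; split => //.
  by under eq_integral => x _ do rewrite gee0_abs//.
have DE k : {ae mu, forall x, D k x = u_ k x - u x}.
  by apply: filterS (LspaceBE (u_ k) u) => x /(_ I).
have DEall : {ae mu, forall x k, D k x = u_ k x - u x} by exact: ae_foralln.
apply: filterS2 (iF measurableT) DEall => x /(_ I) Ffin DEx;
  apply/cvgrPdist_lt => e e0.
have := nneseries_tail_cvg (P := xpredT) _ (fun k _ => D0 k x).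
rewrite -/(F x) -ge0_fin_numE// => /(_ Ffin) /fine_cvgP[tfin tcvg].
have ep0 : 0 < e `^ p by rewrite powR_gt0.
move/cvgrPdist_lt : tcvg => /(_ _ ep0); apply: filterS2 tfin => N tfin.
rewrite sub0r normrN ger0_norm ?fine_ge0 ?nneseries_ge0// => tN.
rewrite distrC -DEx; apply: contra_ltT tN; rewrite -!leNgt => eD.
rewrite -lee_fin fineK//; apply: (@le_trans _ _ ((`|D N x| `^ p)%:E)).
  by rewrite lee_fin ge0_ler_powR ?nnegrE// ltW.
apply: le_trans (nneseries_lim_ge N.+1 _) => //.
by rewrite big_nat1.
Qed.

End Lspace_norm.

Section ae.
Context d (T : measurableType d) (R : realType)
    (mu : {measure set T -> \bar R}).
Implicit Types A B C : set T.

Lemma aeS A B : (forall x, A x -> B x) ->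
  {ae mu, forall x, A x} -> {ae mu, forall x, B x}.
Proof. exact: filterS. Qed.

Lemma aeS2 A B C : (forall x, A x -> B x -> C x) ->
  {ae mu, forall x, A x} -> {ae mu, forall x, B x} -> {ae mu, forall x, C x}.
Proof. exact: filterS2. Qed.

End ae.

Section sections.
Context d1 (Omega : measurableType d1) d2 (T : measurableType d2)
    (R : realType).
Variables (P : probability Omega R)
    (mu : {sigma_finite_measure set T -> \bar R}).
Variables (p : R) (p1 : (1 <= p%:E)%E).
Notation L := (LspaceType mu p1).
Notation LP := (LspaceType (P \x mu)%E p1).

Lemma ae_section (Q : set (Omega * T)) :
  {ae (P \x mu)%E, forall z, Q z} ->
  {ae P, forall w, {ae mu, forall x, Q (w, x)}}.
Proof.
move=> [N [mN N0 QN]].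
have mxN : measurable_fun setT (fun w => mu (xsection N w)).
  exact: measurable_fun_xsection.
have /ae_eq_integral_abs : (\int[P]_w `|mu (xsection N w)| = 0)%E.
  by under eq_integral => w _ do rewrite gee0_abs//; exact: N0.
move=> /(_ measurableT mxN); apply: aeS => w /(_ I)/= Nw.
exists (xsection N w); split => //; first exact: measurable_xsection.
by move=> x /= Qx; rewrite /xsection/= inE; exact: QN.
Qed.

Lemma ae_eq_section (f g : Omega * T -> R) :
  f = g %[ae (P \x mu)%E] ->
  {ae P, forall w, (fun x => f (w, x)) = (fun x => g (w, x)) %[ae mu]}.
Proof. by move=> /ae_section; apply. Qed.

Lemma Lspace_class_eq (f : T -> R) (v : L) : measurable_fun setT f ->
  f = v %[ae mu] -> Lspace_class mu p1 f = v.
Proof.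
move=> mf fv; apply: Lspace_eqP.
have fL : f \in Lfun mu p%:E.
  apply: LfunE => //; rewrite (_ : integral _ _ _ = (`|v| `^ p)%:E) ?ltry//.
  rewrite Lspace_normX; apply: ge0_ae_eq_integral => //.
  - exact: measurable_normXE.
  - by apply: measurable_normXE; exact: Lspace_measurable.
  - by apply: aeS fv => x /(_ I) ->.
by apply: aeS2 (Lspace_classE p1 fL) fv => x /(_ I) -> /(_ I) ->.
Qed.

Lemma section_class_eq (u : LP) (v : Omega -> L) (w : Omega) :
  (fun x => u (w, x)) = v w %[ae mu] ->
  Lspace_class mu p1 (fun x => u (w, x)) = v w.
Proof.
apply: Lspace_class_eq; apply: (measurableT_comp (Lspace_measurable u)).
exact: pair1_measurable.
Qed.

(** By Tonelli almost every section has finite p-norm, so [Lspace_class] does not fall back on the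
    zero class. *)
Lemma section_class_ae (u : LP) : {ae P, forall w,
  (Lspace_class mu p1 (fun x => u (w, x)) : T -> R) = (fun x => u (w, x))
    %[ae mu]}.
Proof.
pose f (z : Omega * T) := (`|u z| `^ p)%:E.
have mf : measurable_fun setT f by exact/measurable_normXE/Lspace_measurable.
have f0 z : (0 <= f z)%E by rewrite lee_fin powR_ge0.
have mF := measurable_fun_fubini_tonelli_F (m2 := mu) _ mf f0.
have /(integrable_ae measurableT) : P.-integrable setT (fubini_F mu f).
  apply/integrableP; split => //.
  under eq_integral => w _ do rewrite gee0_abs ?integral_ge0//.
  by rewrite -fubini_tonelli1// -Lspace_normX ltry.
apply: aeS => w /(_ I) ufin; apply: Lspace_classE; apply: LfunE.
  apply: (measurableT_comp (Lspace_measurable u)); exact: pair1_measurable.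
by move: ufin; rewrite ge0_fin_numE// integral_ge0.
Qed.

(** The approximants take countably many values in [w], hence are jointly measurable once
    representatives of these values are fixed. For [w] in [S] they converge almost everywhere in
    [x], so their upper limit is a representative. *)
Lemma approximable_joint_version (S : set Omega) (v : Omega -> L) :
  approximable S v -> exists2 f : Omega * T -> R, measurable_fun setT f &
    forall w, S w -> (fun x => f (w, x)) = v w %[ae mu].
Proof.
move=> aSv; have r0 k : 0 < (2 ^ k.+1)%:R^-1 :> R.
  by rewrite invr_gt0 ltr0n expn_gt0.
have /choice[e /choice[i H]] k := aSv _ (r0 k).
pose F k (z : Omega * T) := (e k (i k z.1) z.2)%:E.
have mF k : measurable_fun setT (F k).
  apply/measurable_EFinP => _ B mB; rewrite setTI.
  rewrite (_ : _ @^-1` B = \bigcup_m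
      ([set w | i k w = m] `*` (e k m @^-1` B))).
    apply: bigcupT_measurable => m; apply: measurableX; first exact: (H k).1.
    by rewrite -[X in measurable X]setTI; apply: (Lspace_measurable (e k m)).
  apply/seteqP; split => [z Bz|z [m _ [/= <-]//]].
  by exists (i k z.1).
exists (fun z => fine (limn_esup (F ^~ z))).
  apply: measurableT_comp => //; exact: measurable_fun_limn_esup.
move=> w Sw; have uv k := (H k).2 w Sw.
have : {ae mu, forall x, e k (i k w) x @[k --> \oo] --> v w x}.
  by apply: Lspace_ae_cvg => k; rewrite distrC; exact: uv.
apply: aeS => x cv _ /=.
have Fcv : F k (w, x) @[k --> \oo] --> (v w x)%:E by apply: cvg_EFin => //;
  exact: nearW.
rewrite is_cvg_limn_esupE; last by apply/cvg_ex; eexists; exact: Fcv.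
by rewrite (cvg_lim _ Fcv).
Qed.

Lemma Lspace_of_sections (S : set Omega) (v : Omega -> L) (g : Omega -> R) :
  measurable S -> P S = 1%E -> approximable S v ->
  P.-integrable setT (EFin \o g) -> (forall w, S w -> `|v w| `^ p <= g w) ->
  exists u : LP,
    {ae P, forall w, Lspace_class mu p1 (fun x => u (w, x)) = v w}.
Proof.
move=> mS PS aSv ig vg.
have Sae : {ae P, forall w, S w}.
  exists (~` S); split => //; first exact: measurableC.
  by rewrite probability_setC// PS subee.
have [f mf fv] := approximable_joint_version aSv.
pose h (z : Omega * T) := (`|f z| `^ p)%:E.
have mh : measurable_fun setT h by exact: measurable_normXE.
have h0 z : (0 <= h z)%E by rewrite lee_fin powR_ge0.
have mH := measurable_fun_fubini_tonelli_F (m2 := mu) _ mh h0.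
have HE w : S w -> fubini_F mu h w = (`|v w| `^ p)%:E.
  move=> /fv fvw; rewrite Lspace_normX; apply: ge0_ae_eq_integral => //.
  - by apply: (measurableT_comp mh); exact: pair1_measurable.
  - by apply: measurable_normXE; exact: Lspace_measurable.
  - by apply: aeS fvw => x /(_ I) <-.
have fL : f \in Lfun (P \x mu)%E p%:E.
  apply: LfunE => //; rewrite fubini_tonelli1//.
  apply: (@le_lt_trans _ _ (\int[P]_w `|(g w)%:E|)%E); last first.
    by case/integrableP : ig.
  apply: ae_ge0_le_integral => //.
  - by move=> w _; exact: integral_ge0.
  - by apply: measurableT_comp => //; exact: measurable_int ig.
  - apply: aeS Sae => w Sw _; rewrite HE// lee_fin.
    exact: le_trans (vg w Sw) (ler_norm _).
exists (Lspace_class _ p1 f).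
have /ae_eq_section := Lspace_classE p1 fL.
apply: aeS2 Sae => w Sw fw; apply: (section_class_eq (v := v)).
by apply: aeS2 fw (fv w Sw) => x /(_ I) -> /(_ I) ->.
Qed.

(** Tonelli for the p-th power of the norm. As [v] is tied to [u] only up to a null set, its norm
    need not be measurable; [G] is a measurable version. *)
Lemma Lspace_normX_sections (u : LP) (v : Omega -> L) :
  {ae P, forall w, Lspace_class mu p1 (fun x => u (w, x)) = v w} ->
  exists2 G : Omega -> \bar R, measurable_fun setT G &
   {ae P, forall w, (G w = (`|v w| `^ p)%:E)%E} /\
   ((`|u| `^ p)%:E = \int[P]_w G w)%E.
Proof.
move=> uv; pose h (z : Omega * T) := (`|u z| `^ p)%:E.
have mh : measurable_fun setT h by apply: measurable_normXE;
  exact: Lspace_measurable.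
have h0 z : (0 <= h z)%E by rewrite lee_fin powR_ge0.
exists (fubini_F mu h); first exact: measurable_fun_fubini_tonelli_F.
split; last by rewrite Lspace_normX fubini_tonelli1.
apply: aeS2 uv (section_class_ae u) => w <- uw.
rewrite Lspace_normX; apply: ge0_ae_eq_integral => //.
- by apply: (measurableT_comp mh); exact: pair1_measurable.
- by apply: measurable_normXE; exact: Lspace_measurable.
- by apply: aeS uw => x /(_ I) ->.
Qed.

End sections.

(** * The derivative of the L^p norm *)

Section signed_power.
Context (R : realType) (p : R) (p_gt1 : 1 < p).
Implicit Types a b s : R.

Let p0 : 0 < p. Proof. exact: lt_trans p_gt1. Qed.
Let q0 : 0 < p - 1. Proof. by rewrite subr_gt0. Qed.

(* [spow a] is |a|^(p-2) a. *)
Definition spow a : R := Num.sg a * `|a| `^ (p - 1).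

Lemma spow_norm a : `|spow a| = `|a| `^ (p - 1).
Proof.
rewrite /spow normrM normr_sg (ger0_norm (powR_ge0 _ _)).
have [->|_] := eqVneq a 0; last by rewrite mul1r.
by rewrite mul0r normr0 powR0// lt0r_neq0.
Qed.

Lemma spow_mul a : spow a * a = `|a| `^ p.
Proof.
by rewrite /spow mulrAC -normrEsg mulr_powRB1.
Qed.

(** The gradient inequality of the convex function |.|^p, with derivative [p * spow a] at [a]; it
    follows from Young's inequality for |a|^(p-1) and |a + b|. *)
Lemma spow_young a b : p * (spow a * b) <= `|a + b| `^ p - `|a| `^ p.
Proof.
have pN0 : p != 0 by exact: lt0r_neq0.
have qN0 : p - 1 != 0 by exact: lt0r_neq0.
have : `|a| `^ (p - 1) * `|a + b| <=
    (`|a| `^ (p - 1)) `^ (p / (p - 1)) / (p / (p - 1)) + `|a + b| `^ p / p.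
  apply: conjugate_powR => //.
  - exact: divr_gt0.
  - by rewrite invf_div; field.
rewrite -powRrM mulrCA mulfV// mulr1 => young.
have : spow a * (a + b) <= `|a| `^ (p - 1) * `|a + b|.
  by rewrite -spow_norm -normrM ler_norm.
rewrite mulrDr spow_mul => /le_trans/(_ young).
rewrite -(ler_pM2l p0) invf_div [X in _ <= X](_ : _ =
  `|a| `^ p * (p - 1) + `|a + b| `^ p); last by field.
by rewrite mulrDr; lra.
Qed.

(** A weighted Young inequality, split by comparing |a| with s|b|; a small [s] makes the coefficient
    of |b|^p small. *)
Lemma spow_mul_le a b s : 0 < s ->
  `|spow a * b| <= s `^ (p - 1) * `|b| `^ p + `|a| `^ p / s.
Proof.
move=> s0; rewrite normrM spow_norm.
have h0 : 0 <= s `^ (p - 1) * `|b| `^ p by rewrite mulr_ge0 ?powR_ge0.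
have k0 : 0 <= `|a| `^ p / s by rewrite divr_ge0 ?powR_ge0// ltW.
have [ab|ab] := leP `|a| (s * `|b|).
  apply: ler_wpDr => //.
  rewrite -(mulr_powRB1 (normr_ge0 b) p0) mulrA mulrAC ler_wpM2r//.
  rewrite -powRM//; last exact: ltW.
  by rewrite ge0_ler_powR ?nnegrE ?mulr_ge0 ?(ltW q0)// ltW.
apply: ler_wpDl => //; rewrite -(mulr_powRB1 (normr_ge0 a) p0) mulrAC mulrC.
by rewrite ler_wpM2r ?powR_ge0// ler_pdivlMr// mulrC ltW.
Qed.

Lemma powR_add_le a b : 0 <= a -> 0 <= b ->
  (a + b) `^ p <= 2 `^ p * (a `^ p + b `^ p).
Proof.
move=> a0 b0; wlog ab : a b a0 b0 / a <= b => [h|].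
  by have [ab|/ltW ba] := leP a b; [exact: h|rewrite addrC [X in _ * X]addrC;
    exact: h].
apply: (@le_trans _ _ ((2 * b) `^ p)).
  by rewrite ge0_ler_powR ?nnegrE ?addr_ge0 ?mulr_ge0 ?(ltW p0)//; lra.
by rewrite powRM// ler_wpM2l ?powR_ge0// lerDr powR_ge0.
Qed.

Lemma continuous_spow : continuous spow.
Proof.
move=> a; have pos b : 0 < b -> {for b, continuous spow}.
  move=> b0; apply: (@cvg_trans _ (expR ((p - 1) * ln s) @[s --> b])).
    apply: near_eq_cvg; near=> s.
    have s0 : 0 < s by near: s; exact: lt_nbhsr.
    by rewrite /spow gtr0_sg// mul1r gtr0_norm// /powR gt_eqF.
  rewrite /spow gtr0_sg// mul1r gtr0_norm// /powR gt_eqF//.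
  have h : (p - 1) * ln s @[s --> b] --> (p - 1) * ln b.
    exact: (@cvgM _ _ _ _ (fun=> p - 1) _ _ _ (cvg_cst _) (continuous_ln b0)).
  exact: (continuous_cvg _ (@continuous_expR R _) h).
have [->|aN0] := eqVneq a 0.
  rewrite /continuous_at {2}/spow sgr0 mul0r; apply/cvgrPdist_lt => e e0.
  near=> s; rewrite sub0r normrN spow_norm.
  have s_small : `|s| < e `^ (p - 1)^-1.
    near: s; apply: (@nbhs0_lt _ R^o); exact: powR_gt0.
  have -> : e = (e `^ (p - 1)^-1) `^ (p - 1).
    by rewrite -powRrM mulVf ?lt0r_neq0// powRr1// ltW.
  by rewrite gt0_ltr_powR ?nnegrE ?powR_ge0.
have [a0|a0] := ltP 0 a; first exact: pos.
have {}a0 : 0 < - a by rewrite oppr_gt0 lt_neqAle aN0.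
have spowN s : spow s = - spow (- s) by rewrite /spow sgrN normrN mulNr opprK.
have h : - s @[s --> a] --> - a by apply: cvgN; exact: cvg_id.
have h' : (fun s => - spow (- s)) s @[s --> a] --> spow a.
  by rewrite [spow a]spowN; exact: cvgN (continuous_cvg _ (pos _ a0) h).
have E : spow = fun s => - spow (- s) by exact/funext.
by move: h'; rewrite -E.
Unshelve. all: by end_near. Qed.

End signed_power.

Section integrable_EFin.
Context d (T : measurableType d) (R : realType)
    (mu : {measure set T -> \bar R}).
Implicit Types f g : T -> R.

Lemma integrable_EFinZl a f : mu.-integrable setT (EFin \o f) ->
  mu.-integrable setT (EFin \o (fun x => a * f x)).
Proof. exact: integrableZl. Qed.

Lemma integrable_EFinD f g : mu.-integrable setT (EFin \o f) ->
  mu.-integrable setT (EFin \o g) ->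
  mu.-integrable setT (EFin \o (fun x => f x + g x)).
Proof. exact: integrableD. Qed.

Lemma integrable_EFinB f g : mu.-integrable setT (EFin \o f) ->
  mu.-integrable setT (EFin \o g) ->
  mu.-integrable setT (EFin \o (fun x => f x - g x)).
Proof. exact: integrableB. Qed.

End integrable_EFin.

Section spow_pairing.
Context d (T : measurableType d) (R : realType).
Variables (mu : {measure set T -> \bar R}) (p : R) (p_gt1 : 1 < p).
Variable (p1 : (1 <= p%:E)%E).
Notation L := (LspaceType mu p1).
Implicit Types (g h u : L) (f : T -> R).

Let p0 : 0 < p. Proof. exact: lt_trans p_gt1. Qed.

Lemma integrable_normX u f : measurable_fun setT f ->
  (u : T -> R) = f %[ae mu] ->
  mu.-integrable setT (EFin \o (fun x => `|f x| `^ p)) /\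
  \int[mu]_x (`|f x| `^ p) = `|u| `^ p.
Proof.
move=> mf uf.
have E : (\int[mu]_x (`|f x| `^ p)%:E = (`|u| `^ p)%:E)%E.
  rewrite Lspace_normX; apply: ge0_ae_eq_integral => //.
  - exact: measurable_normXE.
  - by apply: measurable_normXE; exact: Lspace_measurable.
  - by apply: aeS uf => x /(_ I) ->.
split; last by rewrite /Rintegral E.
apply/integrableP; split; first exact: measurable_normXE.
under eq_integral => x _ do rewrite /= ger0_norm ?powR_ge0//.
by rewrite E ltry.
Qed.

Lemma measurable_spow_mul f1 f2 : measurable_fun setT f1 ->
  measurable_fun setT f2 -> measurable_fun setT (fun x => spow p (f1 x) * f2 x).
Proof.
move=> m1 m2; apply: measurable_funM => //.
by apply: measurableT_comp m1; apply: continuous_measurable_fun;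
  exact: continuous_spow.
Qed.

Lemma integrable_spow_mul g h f1 f2 :
  measurable_fun setT f1 -> measurable_fun setT f2 ->
  (g : T -> R) = f1 %[ae mu] -> (h : T -> R) = f2 %[ae mu] ->
  mu.-integrable setT (EFin \o (fun x => spow p (f1 x) * f2 x)).
Proof.
move=> m1 m2 /(integrable_normX m1)[i1 _] /(integrable_normX m2)[i2 _].
apply: le_integrable (integrableD measurableT i2 i1) => //.
  by apply/measurable_EFinP; exact: measurable_spow_mul.
move=> x _ /=; rewrite lee_fin [leRHS]ger0_norm ?addr_ge0 ?powR_ge0//.
by have := spow_mul_le p_gt1 (f1 x) (f2 x) ltr01; rewrite powR1 mul1r divr1.
Qed.

Definition spow_pairing g h : R := \int[mu]_x (spow p (g x) * h x).

Lemma integrable_spow_pairing g h :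
  mu.-integrable setT (EFin \o (fun x => spow p (g x) * h x)).
Proof.
exact: (integrable_spow_mul (Lspace_measurable g) (Lspace_measurable h)
  (ae_eq_refl _ _ _) (ae_eq_refl _ _ _)).
Qed.

Lemma spow_pairingE g h f1 f2 :
  measurable_fun setT f1 -> measurable_fun setT f2 ->
  (g : T -> R) = f1 %[ae mu] -> (h : T -> R) = f2 %[ae mu] ->
  spow_pairing g h = \int[mu]_x (spow p (f1 x) * f2 x).
Proof.
move=> m1 m2 gf hf; rewrite /spow_pairing /Rintegral; congr fine.
apply: ae_eq_integral => //.
- exact: measurable_int (integrable_spow_pairing g h).
- by apply/measurable_EFinP; exact: measurable_spow_mul.
- by apply: aeS2 gf hf => x /(_ I) -> /(_ I) ->.
Qed.

Lemma spow_pairing_is_linear g : linear (spow_pairing g).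
Proof.
move=> a h k.
have mg := Lspace_measurable g; have mh := Lspace_measurable h.
have mk := Lspace_measurable k.
have mf : measurable_fun setT (fun x => a * h x + k x).
  by apply: measurable_funD => //; exact: measurable_funM.
have hkE : ((a *: h + k : L) : T -> R) = (fun x => a * h x + k x) %[ae mu].
  apply: aeS2 (LspaceDE (a *: h) k) (LspaceZE a h) => x /(_ I) -> /(_ I) /= ->.
  by [].
rewrite (spow_pairingE mg mf (ae_eq_refl _ _ _) hkE).
transitivity (\int[mu]_x (a * (spow p (g x) * h x) + spow p (g x) * k x)).
  by congr Rintegral; apply/funext => x; ring.
have ih := integrable_spow_pairing g h.
rewrite RintegralD//; last 2 first.
- exact: integrable_EFinZl.
- exact: integrable_spow_pairing.
by rewrite RintegralZl.
Qed.

Lemma spow_pairingD g : {morph spow_pairing g : h k / h + k}.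
Proof. by move=> h k; have := spow_pairing_is_linear g 1 h k;
  rewrite !scale1r. Qed.

Lemma spow_pairingZ g a h : spow_pairing g (a *: h) = a * spow_pairing g h.
Proof.
have g0 : spow_pairing g 0 = 0.
  by have := spow_pairingD g 0 0; rewrite addr0 => /eqP;
    rewrite addrC -subr_eq subrr => /eqP.
by have := spow_pairing_is_linear g a h 0; rewrite g0 !addr0.
Qed.

Lemma spow_pairingN g h : spow_pairing g (- h) = - spow_pairing g h.
Proof. by rewrite -scaleN1r spow_pairingZ mulN1r. Qed.

Lemma spow_pairingB g h k :
  spow_pairing g (h - k) = spow_pairing g h - spow_pairing g k.
Proof. by rewrite spow_pairingD spow_pairingN. Qed.

Lemma spow_pairing_le g h : p * spow_pairing g h <= `|g + h| `^ p - `|g| `^ p.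
Proof.
have mg := Lspace_measurable g; have mh := Lspace_measurable h.
have [i1 <-] := @integrable_normX (g + h) ((g : T -> R) \+ h)
  (measurable_funD mg mh) (LspaceDE g h).
have [i2 <-] := @integrable_normX g _ mg (ae_eq_refl _ _ _).
have ig := integrable_spow_pairing g h.
rewrite -RintegralB// -RintegralZl//; apply: le_Rintegral => //.
- exact: integrable_EFinZl.
- exact: integrable_EFinB.
- by move=> x _; exact: spow_young.
Qed.

Lemma spow_pairing_norm_le g h s : 0 < s ->
  `|spow_pairing g h| <= s `^ (p - 1) * `|h| `^ p + `|g| `^ p / s.
Proof.
move=> s0.
have mg := Lspace_measurable g; have mh := Lspace_measurable h.
have [i1 <-] := @integrable_normX h _ mh (ae_eq_refl _ _ _).
have [i2 <-] := @integrable_normX g _ mg (ae_eq_refl _ _ _).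
have ig := integrable_spow_pairing g h.
apply: (le_trans (le_normr_Rintegral measurableT ig)).
rewrite -RintegralZl// mulrC -RintegralZl// -RintegralD//.
- apply: le_Rintegral => //.
  + exact: integrable_norm.
  + by apply: integrable_EFinD => //; exact: integrable_EFinZl.
  + by move=> x _; rewrite [X in _ + X]mulrC; exact: spow_mul_le.
- exact: integrable_EFinZl.
- exact: integrable_EFinZl.
Qed.

(* With [spow_pairing_le], this makes [p * spow_pairing g h] the derivative of
   [`|g + t *: h| `^ p] at [t = 0]. *)
Lemma spow_pairing_ge g h (c : R) :
  (forall t, 0 < t <= 1 -> c * t <= `|g + t *: h| `^ p - `|g| `^ p) ->
  c <= p * spow_pairing g h.
Proof.
move=> ct; pose t k : R := k.+1%:R^-1.
have t0 k : 0 < t k by rewrite invr_gt0.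
have t1 k : t k <= 1 by rewrite invf_le1// ler1n.
have cvt : t k @[k --> \oo] --> (0 : R) by exact: cvg_harmonic.
have mg := Lspace_measurable g; have mh := Lspace_measurable h.
pose f k x := g x + t k * h x.
have mf k : measurable_fun setT (f k).
  by apply: measurable_funD => //; exact: measurable_funM.
have fE k : ((g + t k *: h : L) : T -> R) = f k %[ae mu].
  apply: aeS2 (LspaceDE g (t k *: h)) (LspaceZE (t k) h).
  by move=> x /(_ I) -> /(_ I) /= ->.
(* The gradient inequality at the displaced point bounds the difference quotient by [p] times the
   pairing there; dominated convergence then lets [t k] tend to 0. *)
have ck k : c <= p * \int[mu]_x (spow p (f k x) * h x).
  rewrite -(spow_pairingE (mf k) mh (fE k) (ae_eq_refl _ _ _)).
  rewrite -(ler_pM2r (t0 k)); apply: (le_trans (ct _ _)).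
    by rewrite t0 t1.
  have := spow_pairing_le (g + t k *: h) (- t k *: h).
  rewrite scaleNr addrK -scaleNr.
  rewrite spow_pairingZ; nra.
have cv : \int[mu]_x (spow p (f k x) * h x) @[k --> \oo] --> spow_pairing g h.
  pose F k x := (spow p (f k x) * h x)%:E.
  pose G x := (2 `^ p * (`|g x| `^ p + `|h x| `^ p) + `|h x| `^ p)%:E.
  have [ig _] := @integrable_normX g _ mg (ae_eq_refl _ _ _).
  have [ih _] := @integrable_normX h _ mh (ae_eq_refl _ _ _).
  have iG : mu.-integrable setT G.
    apply: integrable_EFinD => //; apply: integrable_EFinZl.
    exact: integrable_EFinD.
  have mF k : measurable_fun setT (F k).
    by apply/measurable_EFinP; exact: measurable_spow_mul.
  have igh := integrable_spow_pairing g h.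
  have [] := @dominated_convergence _ _ _ mu setT measurableT F
    (fun x => (spow p (g x) * h x)%:E) G mF _ _ iG _.
  - exact: measurable_int igh.
  - apply: aeW => x _; apply: cvg_EFin; first exact: nearW.
    apply: cvgMr_tmp.
    have cf : f k x @[k --> \oo] --> g x.
      rewrite -[X in _ --> X]addr0 -[X in _ --> _ + X](mul0r (h x)).
      by apply: cvgD; [exact: cvg_cst|exact: cvgMr_tmp].
    exact: (continuous_cvg _ (@continuous_spow _ _ p_gt1 _) cf).
  - apply: aeW => x j _; rewrite lee_fin.
    apply: (le_trans (spow_mul_le p_gt1 (f j x) (h x) ltr01)).
    rewrite powR1 mul1r divr1 addrC lerD2r.
    apply: le_trans (powR_add_le p_gt1 (normr_ge0 _) (normr_ge0 _)).
    rewrite ge0_ler_powR ?nnegrE ?addr_ge0 ?(ltW p0)//.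
    rewrite (le_trans (ler_normD _ _))// lerD2l normrM (gtr0_norm (t0 j)).
    by rewrite ler_piMl.
  move=> _ _; rewrite /spow_pairing /Rintegral => cv.
  apply: fine_cvg; rewrite fineK; first exact: cv.
  exact: integrable_fin_num igh.
have cvp := cvgMl_tmp (a := p) cv.
exact: (@cvgr_to_ge _ _ _ R _ _ _ (cvp _) (nearW _ ck)).
Qed.

Definition spow_functional g : {linear L -> R} := HB.pack (spow_pairing g)
  (GRing.isLinear.Build R L R _ (spow_pairing g) (spow_pairing_is_linear g)).

Lemma continuous_spow_pairing g : continuous (spow_pairing g).
Proof.
apply/(linear_bounded_continuous (spow_functional g)).
exists (1 + `|g| `^ p); split; first exact: num_real.
move=> M gM; near=> h; apply: ltW; apply: le_lt_trans gM.
have := spow_pairing_norm_le g h ltr01; rewrite powR1 mul1r divr1 => /le_trans.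
apply; rewrite lerD2r; have h1 : `|h| <= 1 by near: h; exact: nbhs0_le.
have [->|hN0] := eqVneq h 0; first by rewrite normr0 powR0 ?lt0r_neq0.
by apply: (le_trans _ h1); apply: ge1r_powR; [rewrite normr_gt0 hN0|exact: ltW].
Unshelve. all: by end_near. Qed.

End spow_pairing.

(* The pairing with [g] is a derivative of a power of the norm at [g], hence is
   preserved by an isometry fixing [g]. *)
Lemma spow_pairing_isometry d (T : measurableType d) (R : realType)
    (mu : {measure set T -> \bar R}) (p : R) (p_gt1 : 1 < p)
    (p1 : (1 <= p%:E)%E) (S : LspaceType mu p1 -> LspaceType mu p1)
    (g u : LspaceType mu p1) :
  linear S -> (forall v, `|S v| = `|v|) -> S g = g ->
  spow_pairing g (S u) = spow_pairing g u.
Proof.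
move=> linS isoS Sg.
have p0 : 0 < p by exact: lt_trans p_gt1.
have S0 : S 0 = 0 by have := isoS 0; rewrite normr0 => /eqP;
  rewrite normr_eq0 => /eqP.
have SZ t v : S (t *: v) = t *: S v by have := linS t v 0; rewrite S0 !addr0.
have SD v v' : S (v + v') = S v + S v' by have := linS 1 v v'; rewrite !scale1r.
(* Since |g + t S v| = |g + t v|, [spow_pairing_ge] yields one inequality; its instance at [- u]
   yields the reverse one. *)
have le v : spow_pairing g (S v) <= spow_pairing g v.
  rewrite -(ler_pM2l p0); apply: spow_pairing_ge => // t _.
  rewrite -isoS SD Sg SZ; apply: le_trans (spow_pairing_le p_gt1 _ _).
  by rewrite (spow_pairingZ p_gt1) -mulrA ler_wpM2l ?(ltW p0)// mulrC.
apply/eqP; rewrite eq_le le/=; have := le (- u).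
by rewrite -scaleN1r SZ !(spow_pairingZ p_gt1) !mulN1r lerN2.
Qed.

Lemma integral_cst_probability d (Omega : measurableType d) (R : realType)
    (P : probability Omega R) (a : R) : (\int[P]_w a%:E = a%:E)%E.
Proof.
rewrite [LHS](integral_cst P measurableT) -[RHS]mule1; congr (_ * _)%E.
exact: probability_setT.
Qed.

(** * Functions on the product space that are constant in the sample *)

Section lift.
Context d1 (Omega : measurableType d1) d2 (T : measurableType d2)
    (R : realType).
Variables (P : probability Omega R)
    (mu : {sigma_finite_measure set T -> \bar R}).
Variables (p : R) (p_gt1 : 1 < p) (p1 : (1 <= p%:E)%E).
Notation L := (LspaceType mu p1).
Notation LP := (LspaceType (P \x mu)%E p1).
Notation lift g := (Lspace_class (P \x mu)%E p1 (fun z => (g : L) z.2)).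
Notation sect u w := (Lspace_class mu p1 (fun x => (u : LP) (w, x))).

Lemma measurable_fun_snd (f : T -> R) : measurable_fun setT f ->
  measurable_fun setT (fun z : Omega * T => f z.2).
Proof. by move=> mf; exact: measurableT_comp. Qed.

Lemma lift_ae (g : L) : (lift g : Omega * T -> R) = (fun z => g z.2)
  %[ae (P \x mu)%E].
Proof.
have mg := measurable_fun_snd (Lspace_measurable g).
apply: Lspace_classE; apply: LfunE => //.
have mh := measurable_normXE p mg.
rewrite (fubini_tonelli1 _ mh) => [|z]; last by rewrite lee_fin powR_ge0.
rewrite /fubini_F/= -Lspace_normX; apply: integrable_lty => //.
exact: finite_measure_integrable_cst.
Qed.

Lemma sect_lift_ae (g : L) : {ae P, forall w, sect (lift g) w = g}.
Proof.
have /ae_eq_section := lift_ae g; apply: aeS => w gw.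
exact: (section_class_eq (v := fun=> g)).
Qed.

(** Fubini for the pairing with a deterministic function; [H] is an integrable version of the
    pairing of the sections. *)
Lemma spow_pairing_lift (g : L) (u : LP) :
  exists2 H : Omega -> \bar R, P.-integrable setT H &
    {ae P, forall w, H w = (spow_pairing g (sect u w))%:E} /\
    (\int[P]_w H w = (spow_pairing (lift g) u)%:E)%E.
Proof.
have mg := Lspace_measurable g; have mu' := Lspace_measurable u.
have mg2 := measurable_fun_snd mg.
pose f (z : Omega * T) := (spow p (g z.2) * u z)%:E.
have imf : (P \x mu)%E.-integrable setT f.
  exact: (integrable_spow_mul p_gt1 mg2 mu' (lift_ae g) (ae_eq_refl _ _ _)).
exists (fubini_F mu f); first exact: integrable_fubini_F.
split; last first.
  rewrite integral12_prod_meas1//.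
  rewrite (spow_pairingE p_gt1 mg2 mu' (lift_ae g) (ae_eq_refl _ _ _)).
  by rewrite /Rintegral fineK//; exact: integrable_fin_num imf.
apply: aeS (section_class_ae u) => w uw.
have muw : measurable_fun setT (fun x => u (w, x)).
  by apply: (measurableT_comp mu'); exact: pair1_measurable.
rewrite (spow_pairingE p_gt1 mg muw (ae_eq_refl _ _ _) uw).
rewrite /Rintegral fineK//; apply: integrable_fin_num => //.
exact: (integrable_spow_mul p_gt1 mg muw (ae_eq_refl _ _ _) uw).
Qed.

Lemma spow_pairing_lift_lift (g u : L) :
  spow_pairing (lift g) (lift u) = spow_pairing g u.
Proof.
have [H iH [HE HI]] := spow_pairing_lift g (lift u).
apply: EFin_inj; rewrite -HI -(integral_cst_probability P (spow_pairing g u)).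
apply: ae_eq_integral => //; first exact: measurable_int iH.
by apply: aeS2 HE (sect_lift_ae u) => w -> ->.
Qed.

End lift.

(** * Unfolding of deterministic functions *)

Section unfolding.
Context (R : realType) (n : nat) d (Omega : measurableType d).
Variables (P : probability Omega R) (tau : 'rV[R]_n -> Omega -> Omega).
Variables (Q : set 'rV[R]_n) (oQ : open Q) (p : R) (p_gt1 : 1 < p).
Notation LpQ := (Lp_Q oQ p_gt1).
Notation LpOQ := (Lp_OmegaQ P oQ p_gt1).

(** The lift is the simple tensor of the constant 1 with [u], and shifting the sample leaves the
    constant unchanged. *)
Lemma unfolding_lift_const (e : R) (T : LpOQ -> LpOQ) (u : LpQ) :
  unfolding tau e T -> T (lift_const P u) = lift_const P u.
Proof.
move=> [_ _ _ tens]; apply: Lspace_eqP.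
have lu := lift_ae P u.
have := tens 1%N (fun=> cst 1) (fun=> u) (lift_const P u).
have one : cst 1 \in Lfun P p%:E by exact: Lfun_cst.
have uL : (u : _ -> R) \in Lfun (lebesgue_on oQ) p%:E by exact: Lspace_Lfun.
move=> /(_ (fun=> one) (fun=> uL)).
have H : {ae (P \x lebesgue_on oQ)%E, forall z, setT z ->
    lift_const P u z = \sum_(i < 1) cst 1 z.1 * u z.2}.
  by apply: aeS lu => z /(_ I) zu _; rewrite big_ord1 mul1r.
move=> /(_ H); move: lu; apply: aeS2 => z /(_ I) zu /(_ I) ->.
by rewrite big_ord1 mul1r.
Qed.

(** Unfolding is an isometry fixing the limit, so the unfolded family stays at the same distance
    from it. *)
Lemma strong_two_scale_cvg (T : R -> LpOQ -> LpOQ) (v : R -> LpOQ) (u : LpQ) :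
  (forall e, 0 < e -> unfolding tau e (T e)) ->
  v e @[e --> 0^'+] --> lift_const P u ->
  two_scale_cvg T v (lift_const P u).
Proof.
move=> uT vu f cf; apply: (continuous_cvg _ (cf (lift_const P u))).
apply/cvgrPdist_lt => r r0; move/cvgrPdist_lt : vu => /(_ _ r0).
apply: filter_app; near=> e; rewrite !(distrC (lift_const P u)) => vr.
have e0 : 0 < e by [].
have [linT isoT _ _] := uT e e0.
have := isoT (v e - lift_const P u).
have TB a b : T e (a - b) = T e a - T e b.
  by have := linT (-1) b a; rewrite !scaleN1r ![- _ + _]addrC.
by rewrite TB (unfolding_lift_const u (uT e e0)) => ->.
Unshelve. all: by end_near. Qed.

End unfolding.

(** * Gamma-limits of coercive functionals *)

Section gamma.
Context (R : realType) (V : normedModType R).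
Variables (E : R -> V -> \bar R) (G : V -> \bar R).
Hypothesis EG : gamma_cvg0 E G.
Implicit Types (u v z : V) (c a b r : R).

(** A sequence of low-energy points is completed to a family by the value [v] at all other scales;
    the lower limit over all scales is at most the one along the sequence. *)
Lemma gamma_seq_le v (c : \bar R) :
  (forall r, 0 < r -> exists e z, [/\ 0 < e < r,
    `|z - v| < r & (E e z <= c)%E]) ->
  (G v <= c)%E.
Proof.
move=> h; pose r k : R := k.+1%:R^-1.
have r0 k : 0 < r k by rewrite invr_gt0.
have /choice[e /choice[z ez]] k := h (r k) (r0 k).
pose w x := if pselect (exists k, x = e k) is left kx
  then z (sval (cid kx)) else v.
have wv : w x @[x --> 0^'+] --> v.
  apply/cvgrPdist_lt => s s0; have [k ks] := ltr_add_invr s0.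
  rewrite add0r in ks.
  (* Several indices may share a scale and [cid] picks any of them; strictly below the first [k + 1]
     scales, each such index exceeds [k]. *)
  have [m [m0 me]] : exists m, 0 < m /\ forall j, (j <= k)%N -> m <= e j.
    elim: k {ks} => [|k [m [m0 me]]].
      exists (e 0%N); split; first by have [/andP[]] := ez 0%N.
      by move=> j; rewrite leqn0 => /eqP ->.
    exists (Num.min m (e k.+1)); split.
      by rewrite lt_min m0; have [/andP[]] := ez k.+1.
    move=> j; rewrite leq_eqVlt => /predU1P[->|jk];
      first by rewrite ge_min lexx orbT.
    by rewrite ge_min me.
  near=> x; rewrite /w; case: pselect => [kx|_]; last by rewrite subrr normr0.
  case: cid => j /= xj; rewrite distrC.
  have xm : x < m by near: x; exact: nbhs_right_lt.
  have kj : (k < j)%N.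
    by rewrite ltnNge; apply/negP => /me; rewrite -xj leNgt xm.
  have [_ zj _] := ez j; apply: lt_trans zj _; apply: le_lt_trans ks.
  by rewrite lef_pV2 ?posrE// ler_nat ltnS ltnW.
have := EG.1 _ _ wv; move=> /le_trans; apply.
rewrite /liminf0 limf_einfE; apply: ge_ereal_sup => _ [B /= B0 <-].
have [s /= s0 sB] := B0.
have [k ks] := ltr_add_invr s0; rewrite add0r in ks.
have Bek : B (e k).
  have [/andP[ek0 ekr] _ _] := ez k.
  apply: sB => //=; rewrite sub0r normrN gtr0_norm//.
  exact: lt_trans ks.
apply: (@le_trans _ _ (E (e k) (w (e k)))).
  by apply: ereal_inf_lbound; exists (e k).
rewrite /w; case: pselect => [kx|[]]; last by exists k.
by case: cid => j /= ->; have [] := ez j.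
Unshelve. all: by end_near. Qed.

Lemma gamma_recovery v (c : \bar R) r : (G v < c)%E -> 0 < r ->
  \forall e \near 0^'+, exists2 z, `|z - v| < r & (E e z < c)%E.
Proof.
move=> vc r0; have [z zv Ez] := EG.2 v.
have Ez' : \forall e \near 0^'+, (E e (z e) < c)%E := Ez _ (open_ereal_lt' vc).
move/cvgrPdist_lt : zv => /(_ _ r0); apply: filterS2 Ez' => e Ec ze.
by exists (z e) => //; rewrite distrC.
Qed.

Lemma gamma_lsc u c :
  (forall r, 0 < r -> exists2 z, `|z - u| < r & (G z <= c%:E)%E) ->
  (G u <= c%:E)%E.
Proof.
move=> h; apply/lee_addgt0Pr => s s0; apply: gamma_seq_le => r r0.
have r20 : 0 < r / 2 by rewrite divr_gt0.
have [z zu zc] := h _ r20.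
have zcs : (G z < c%:E + s%:E)%E by apply: le_lt_trans zc _; rewrite lteDl.
near (0 : R)^'+ => e.
have [z' z'z Ez'] : exists2 z', `|z' - z| < r / 2 & (E e z' < c%:E + s%:E)%E.
  by near: e; exact: gamma_recovery.
exists e, z'; split; last exact: ltW.
- by apply/andP; split => //; near: e; exact: nbhs_right_lt.
- by rewrite (splitr r) -(subrKA z);
    exact: (le_lt_trans (ler_normD _ _) (ltrD z'z zu)).
Unshelve. all: by end_near. Qed.

(** Recovery points of [u] and [v] are combined at a common scale. Real upper bounds replace the
    values of [G], avoiding arithmetic with infinity. *)
Lemma gamma_convex u v a b t : 0 <= t <= 1 ->
  (forall e, 0 < e -> convex_functional (E e)) ->
  (G u <= a%:E)%E -> (G v <= b%:E)%E ->
  (G (t *: u + (1 - t) *: v)%R <= (t * a + (1 - t) * b)%:E)%E.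
Proof.
move=> t01 cE ua vb; apply/lee_addgt0Pr => s s0; apply: gamma_seq_le => r r0.
have us : (G u < (a + s)%:E)%E by apply: le_lt_trans ua _;
  rewrite lte_fin ltrDl.
have vs : (G v < (b + s)%:E)%E by apply: le_lt_trans vb _;
  rewrite lte_fin ltrDl.
have /andP[t0 t1] := t01; have t1' : 0 <= 1 - t by rewrite subr_ge0.
near (0 : R)^'+ => e.
have [u' u'u Eu'] : exists2 z, `|z - u| < r & (E e z < (a + s)%:E)%E.
  by near: e; exact: gamma_recovery.
have [v' v'v Ev'] : exists2 z, `|z - v| < r & (E e z < (b + s)%:E)%E.
  by near: e; exact: gamma_recovery.
exists e, (t *: u' + (1 - t) *: v'); split.
- by apply/andP; split => //; near: e; exact: nbhs_right_lt.
- have -> : t *: u' + (1 - t) *: v' - (t *: u + (1 - t) *: v) =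
      t *: (u' - u) + (1 - t) *: (v' - v).
    by rewrite !scalerBr opprD addrACA.
  apply: le_lt_trans (ler_normD _ _) _; rewrite !normrZ !ger0_norm//.
  have [->|tN0] := eqVneq t 0; first by rewrite mul0r add0r subr0 mul1r.
  rewrite [ltRHS](_ : r = t * r + (1 - t) * r); last by ring.
  by apply: ltr_leD; [rewrite ltr_pM2l// lt_neqAle eq_sym tN0|rewrite
    ler_wpM2l// ltW].
- have e0 : 0 < e by [].
  apply: (le_trans (cE e e0 u' v' t t01)).
  apply: (@le_trans _ _ (t%:E * (a + s)%:E + (1 - t)%:E * (b + s)%:E)%E).
    by apply: leeD; apply: lee_wpmul2l; rewrite ?lee_fin//; exact: ltW.
  by rewrite -!EFinM -!EFinD lee_fin; lra.
Unshelve. all: by end_near. Qed.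

Lemma gamma_ge v c : (forall e z,
  0 < e -> (c%:E <= E e z)%E) -> (c%:E <= G v)%E.
Proof.
move=> h; rewrite leNgt; apply/negP => vc.
near (0 : R)^'+ => e.
have [z _] : exists2 z, `|z - v| < 1 & (E e z < c%:E)%E.
  by near: e; exact: gamma_recovery.
by apply/negP; rewrite -leNgt h.
Unshelve. all: by end_near. Qed.

Lemma gamma_sublevel (K : set V) v c : closed K ->
  (forall e z, 0 < e -> (E e z <= (c + 1)%:E)%E -> K z) ->
  (G v <= c%:E)%E -> K v.
Proof.
move=> cK EK vc; apply: cK => B /nbhs_ballP[r /= r0 rB].
near (0 : R)^'+ => e.
have [z zv Ez] : exists2 z, `|z - v| < r & (E e z < (c + 1)%:E)%E.
  near: e; apply: gamma_recovery => //.
  by apply: le_lt_trans vc _; rewrite lte_fin ltrDl.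
exists z; split; first by apply: (EK e) => //; exact: ltW.
by apply: rB; rewrite -ball_normE /= distrC.
Unshelve. all: by end_near. Qed.

End gamma.

(** * Subgradients of Gamma-limits by Moreau-Yosida regularization *)

Section moreau.
Context d (T : measurableType d) (R : realType).
Variables (mu : {measure set T -> \bar R}) (p : R) (p_gt1 : 1 < p).
Variable (p1 : (1 <= p%:E)%E).
Notation L := (LspaceType mu p1).
Implicit Types (u v z : L) (a b c r t : R).

Let p0 : 0 < p. Proof. exact: lt_trans p_gt1. Qed.

Lemma spow_pairing_self (g : L) : spow_pairing g g = `|g| `^ p.
Proof.
have mg := Lspace_measurable g.
have [_ <-] := integrable_normX mg (ae_eq_refl _ _ _).
by congr Rintegral; apply/funext => x; rewrite spow_mul.
Qed.

Lemma spow_pairing_nbhs (g z : L) r : 0 < r ->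
  \forall v \near z, `|spow_pairing g (v - z)| < r.
Proof.
move=> r0; have /cvgrPdist_lt/(_ _ r0) :=
  @continuous_spow_pairing _ _ _ _ _ p_gt1 p1 g z.
by apply: filterS => v; rewrite distrC -(spow_pairingB p_gt1).
Qed.

Section minimizer.
Variables (G : L -> \bar R) (C : R).
Hypothesis G_ge : forall v, ((- C)%:E <= G v)%E.
Hypothesis G_lsc : forall u c,
  (forall r, 0 < r -> exists2 z, `|z - u| < r & (G z <= c%:E)%E) ->
  (G u <= c%:E)%E.
Hypothesis G_convex : forall u v a b t, 0 <= t <= 1 ->
  (G u <= a%:E)%E -> (G v <= b%:E)%E ->
  (G (t *: u + (1 - t) *: v)%R <= (t * a + (1 - t) * b)%:E)%E.
Hypothesis G_compact : forall c, exists2 K : set L, compact K &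
  forall v, (G v <= c%:E)%E -> K v.
Hypothesis G_proper : exists z a, (G z <= a%:E)%E.

Lemma Moreau_Yosida_minimizer u (lam : R) : 0 < lam ->
  exists z a, (G z <= a%:E)%E /\
    forall v b, (G v <= b%:E)%E ->
      a + lam * `|u - z| `^ p <= b + lam * `|u - v| `^ p.
Proof.
move=> lam0.
pose S := [set s | exists v b, (G v <= b%:E)%E /\ s = b + lam * `|u - v| `^ p].
have Slb : lbound S (- C).
  move=> _ [v [b [vb ->]]]; have := le_trans (G_ge v) vb; rewrite lee_fin.
  by move=> /le_trans; apply; rewrite lerDl mulr_ge0 ?powR_ge0// ltW.
have S0 : S !=set0.
  by have [z [a za]] := G_proper; exists (a + lam * `|u - z| `^ p); exists z, a.
have hS : has_inf S by split=> //; exists (- C).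
have [m mE] : {m | m = inf S} by exists (inf S).
have mS v b : (G v <= b%:E)%E -> m <= b + lam * `|u - v| `^ p.
  by move=> vb; rewrite mE; apply: ge_inf; [exists (- C)|exists v, b].
have /choice[x hx] (k : nat) : exists v, exists2 b, (G v <= b%:E)%E &
    b + lam * `|u - v| `^ p < m + k.+1%:R^-1.
  have k0 : 0 < k.+1%:R^-1 :> R by rewrite invr_gt0.
  have [_ [v [b [vb ->]]]] := inf_adherent k0 hS; rewrite -mE => h.
  by exists v, b.
have [K cK GK] := G_compact (m + 1).
have Kx k : K (x k).
  have [b xb h] := hx k; apply: GK; apply: le_trans xb _; rewrite lee_fin.
  have k1 : k.+1%:R^-1 <= 1 :> R by rewrite invf_le1// ler1n.
  have X0 : 0 <= lam * `|u - x k| `^ p by rewrite mulr_ge0 ?powR_ge0// ltW.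
  apply: (@le_trans _ _ (b + lam * `|u - x k| `^ p)); first by rewrite lerDl.
  by apply: (le_trans (ltW h)); rewrite lerD2l.
have [z Kz zx] := compact_cluster_seq cK Kx.
(* With [a] the infimum minus the penalty at [z], minimality is immediate; what remains is that
   [G z] is at most [a]. *)
exists z, (m - lam * `|u - z| `^ p); split => [|v b vb]; last first.
  by rewrite subrK; exact: mS.
apply/lee_addgt0Pr => s s0; rewrite -EFinD; apply: G_lsc => r r0.
have s20 : 0 < s / 2 by rewrite divr_gt0.
have [n ns] := ltr_add_invr s20; rewrite add0r in ns.
have lp0 : 0 < s / 2 / (lam * p) by rewrite divr_gt0// mulr_gt0.
(* Smallness of the pairing and the gradient inequality at [u - z] keep the penalty at [x k] from
   falling more than s/2 below that at [z]; the other s/2 pays for [x k] being only nearly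
   optimal. *)
have B : \forall v \near z, `|v - z| < r /\
    `|spow_pairing (u - z) (v - z)| < s / 2 / (lam * p).
  near=> v; split; last by near: v; exact: spow_pairing_nbhs.
  by rewrite distrC; near: v; exact: (@cvgr_dist_lt _ _ _ _ _ id z).
have [k nk [xz pz]] := zx _ B n.
exists (x k) => //; have [b xb h] := hx k; apply: le_trans xb _;
  rewrite lee_fin.
have kn : k.+1%:R^-1 <= n.+1%:R^-1 :> R by rewrite lef_pV2 ?posrE// ler_nat.
have := spow_pairing_le p_gt1 (u - z) (z - x k); rewrite subrKA.
rewrite -(opprB (x k) z) (spow_pairingN p_gt1) => le1.
have {pz} : lam * p * spow_pairing (u - z) (x k - z) < s / 2.
  rewrite mulrC -ltr_pdivlMr ?mulr_gt0//; exact: le_lt_trans (ler_norm _) pz.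
move: le1 h; move: (spow_pairing _ _) (_ `^ p) (_ `^ p) => A Y X le1 h le2.
have le3 : lam * (p * - A) <= lam * (X - Y) by rewrite ler_wpM2l// ltW.
have : lam * (p * - A) = - (lam * p * A) by ring.
rewrite mulrBr in le3; have := le_lt_trans kn ns.
by move: h; move: (k.+1%:R^-1) => ik; lra.
Unshelve. all: by end_near. Qed.

(** Stationarity of the minimizer: it is compared with points moved by [t] towards [v], where
    convexity bounds [G], and [spow_pairing_ge] differentiates the penalty at [t = 0]. *)
Lemma Moreau_Yosida_subgradient u (lam : R) : 0 < lam ->
  exists z a, (G z <= a%:E)%E /\
    forall v b, (G v <= b%:E)%E ->
      a + lam * p * spow_pairing (u - z) (v - z) <= b.
Proof.
move=> lam0; have [z [a [za zmin]]] := Moreau_Yosida_minimizer u lam0.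
exists z, a; split => // v b vb.
have : (a - b) / lam <= p * spow_pairing (u - z) (z - v).
  apply: (spow_pairing_ge p_gt1) => t /andP[t0 t1].
  have t01 : 0 <= t <= 1 by rewrite ltW.
  have := zmin _ _ (G_convex t01 vb za).
  have -> : u - (t *: v + (1 - t) *: z) = u - z + t *: (z - v).
    rewrite scalerBl scale1r scalerBr opprD opprB -[RHS]addrA; congr (u + _).
    by rewrite [LHS]addrC [t *: z - z]addrC -addrA.
  rewrite mulrAC ler_pdivrMr//; lra.
rewrite ler_pdivrMr// -(opprB v z) (spow_pairingN p_gt1); lra.
Qed.

End minimizer.

Lemma spow_pairing_absorb (g : L) (kappa a0 s : R) : 0 <= kappa -> 0 < s ->
  exists c, forall v, kappa * spow_pairing g v + a0 <= s * `|v| `^ p + c.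
Proof.
(* The weight for [spow_pairing_norm_le] with kappa q^(p-1) <= s; the added 1 keeps the denominator
   positive when [kappa] vanishes. *)
move=> k0 s0; pose q := (s / (kappa + 1)) `^ (p - 1)^-1.
have pm : 0 < p - 1 by rewrite subr_gt0.
have sk : 0 < s / (kappa + 1) by rewrite divr_gt0// ltr_wpDl.
have q0 : 0 < q by exact: powR_gt0.
have qE : q `^ (p - 1) = s / (kappa + 1).
  by rewrite /q -powRrM mulVf ?lt0r_neq0// powRr1// ltW.
exists (kappa * (`|g| `^ p / q) + a0) => v; rewrite addrA lerD2r.
have := spow_pairing_norm_le p_gt1 g v q0;
  rewrite qE => /(le_trans (ler_norm _)).
move=> /(ler_wpM2l k0)/le_trans; apply; rewrite mulrDr lerD2r mulrA.
rewrite ler_wpM2r ?powR_ge0// mulrA ler_pdivrMr ?ltr_wpDl// mulrC.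
by rewrite ler_wpM2l// ?(ltW s0)//; lra.
Qed.

(** Violations at arbitrarily small scales lie in [K] and cluster at some [y]; the liminf inequality
    along them would put [G y] below the affine function at [y]. *)
Lemma gamma_affine_minorant (E : R -> L -> \bar R) (G : L -> \bar R)
    (K : set L) (g : L) (kappa a0 s : R) :
  gamma_cvg0 E G -> compact K ->
  (forall e v, 0 < e -> (E e v < (kappa * spow_pairing g v + a0)%:E)%E -> K v)
    ->
  (forall v b, (G v <= b%:E)%E -> kappa * spow_pairing g v + a0 <= b) ->
  0 < s ->
  \forall e \near 0^'+, forall v,
    ((kappa * spow_pairing g v + a0 - s)%:E <= E e v)%E.
Proof.
move=> EG cK EK GA s0; apply: contrapT => nE.
have /choice[e /choice[x hx]] k : exists e v, 0 < e < k.+1%:R^-1 /\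
    (E e v < (kappa * spow_pairing g v + a0 - s)%:E)%E.
  apply: contrapT => h; apply: nE.
  have ek : \forall e \near (0 : R)^'+, 0 < e < k.+1%:R^-1.
    have k0 : 0 < k.+1%:R^-1 :> R by rewrite invr_gt0.
    by apply: filterS2 (nbhs_right_gt 0) (nbhs_right_lt k0) => e -> ->.
  apply: filterS ek => e e0k v; rewrite leNgt; apply/negP => Ev.
  by apply: h; exists e, v.
have Kx k : K (x k).
  have [/andP[e0 _] Ex] := hx k; apply: (EK (e k)) => //; apply: lt_trans Ex _.
  by rewrite lte_fin ltrBlDr ltrDl.
have [y Ky yx] := compact_cluster_seq cK Kx.
have s20 : 0 < s / 2 by rewrite divr_gt0.
pose A v := kappa * spow_pairing g v + a0.
have : (G y <= (A y - s / 2)%:E)%E.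
  apply: (gamma_seq_le EG) => r r0.
  have [n nr] := ltr_add_invr r0; rewrite add0r in nr.
  have k0 : 0 < s / 2 / (`|kappa| + 1) by rewrite divr_gt0// ltr_wpDl.
  have B : \forall v \near y, `|v - y| < r /\
      `|spow_pairing g (v - y)| < s / 2 / (`|kappa| + 1).
    near=> v; split; last by near: v; exact: spow_pairing_nbhs.
    by rewrite distrC; near: v; exact: (@cvgr_dist_lt _ _ _ _ _ id y).
  have [k nk [xy pxy]] := yx _ B n.
  have [/andP[e0 en] Ex] := hx k; exists (e k), (x k); split => //.
    rewrite e0/=; apply: lt_trans en _; apply: le_lt_trans nr.
    by rewrite lef_pV2 ?posrE// ler_nat.
  apply: le_trans (ltW Ex) _; rewrite lee_fin /A.
  have : kappa * spow_pairing g (x k - y) <= s / 2.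
    apply: le_trans (ler_norm _) _; rewrite normrM.
    apply: (@le_trans _ _ ((`|kappa| + 1) * (s / 2 / (`|kappa| + 1)))).
      by apply: ler_pM => //; [rewrite lerDl|exact: ltW].
    by rewrite mulrC divfK// lt0r_neq0// ltr_wpDl.
  by rewrite (spow_pairingB p_gt1) mulrBr; lra.
by move=> /GA; rewrite /A; lra.
Unshelve. all: by end_near. Qed.

End moreau.

(** * Random functionals *)

(* The Lebesgue integral of the library is also defined, as a difference of
   lower integrals, for functions that are not measurable; it is monotone
   there too. *)
Section integral_not_measurable.
Context d (T : measurableType d) (R : realType)
    (mu : {measure set T -> \bar R}).
Local Open Scope ereal_scope.
Import HBNNSimple.

Lemma ge0_le_integral_ae (f g : T -> \bar R) :
  (forall x, 0 <= f x) -> (forall x, 0 <= g x) ->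
  {ae mu, forall x, f x <= g x} -> \int[mu]_x f x <= \int[mu]_x g x.
Proof.
move=> f0 g0 [N [mN N0 fgN]]; rewrite !ge0_integralTE//.
apply: ge_ereal_sup => _ [h hf <-].
(* A simple function below [f], cut off on the null set [N], keeps its integral and lies below
   [g]. *)
pose k := proj_nnsfun h (measurableC mN).
have -> : sintegral mu h = sintegral mu k.
  rewrite -!integralT_nnsfun; apply: ge0_ae_eq_integral => //.
  - exact/measurable_EFinP.
  - exact/measurable_EFinP.
  - by move=> x _; rewrite lee_fin.
  - by move=> x _; rewrite lee_fin.
  - exists N; split => // x /= hk; apply: contrapT => Nx; apply: hk => _.
    by rewrite /= mindicE mem_set// mulr1.
apply: ereal_sup_ubound; exists k => // x /=; rewrite mindicE.
have [Nx|Nx] := pselect (N x).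
  by rewrite memNset ?mulr0//; exact.
rewrite mem_set// mulr1; apply: (le_trans (hf x)).
by apply: contrapT => fg; apply: Nx; exact: fgN.
Qed.

Lemma le_integral_ae (f g : T -> \bar R) :
  {ae mu, forall x, f x <= g x} -> \int[mu]_x f x <= \int[mu]_x g x.
Proof.
move=> fg; rewrite integralE [leRHS]integralE; apply: leeB.
- apply: ge0_le_integral_ae => //; apply: aeS fg => x fgx.
  by rewrite !funeposE ge_max !le_max fgx lexx orbT.
- apply: ge0_le_integral_ae => //; apply: aeS fg => x fgx.
  by rewrite !funenegE ge_max !le_max leeN2 fgx lexx orbT.
Qed.

End integral_not_measurable.

Section near_measure.
Context d (Omega : measurableType d) (R : realType) (P : probability Omega R).

(** A reverse Fatou argument: if the probabilities stayed at least [eta] along scales tending to 0,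
    so would that of the upper limit of the events, whose points, up to a null set, lie in [B e] for
    arbitrarily small [e]. [B e] may be nonmeasurable and is replaced by [M e]. *)
Lemma near_measure_lt (Omega' : set Omega) (B M : R -> set Omega) (eta : R) :
  measurable Omega' -> P Omega' = 1%E ->
  (forall e, 0 < e -> measurable (M e)) ->
  (forall e, 0 < e -> P.-negligible (M e `\` B e)) ->
  (forall w, Omega' w -> \forall e \near 0^'+, ~ B e w) ->
  0 < eta -> \forall e \near 0^'+, (P (M e) < eta%:E)%E.
Proof.
move=> mO PO mM MB hB eta0; apply: contrapT => nP.
have /choice[e he] (k : nat) : exists e : R, 0 < e < k.+1%:R^-1 /\
    (eta%:E <= P (M e))%E.
  apply: contrapT => h; apply: nP.
  have k0 : 0 < k.+1%:R^-1 :> R by rewrite invr_gt0.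
  apply: filterS2 (nbhs_right_gt 0) (nbhs_right_lt k0) => e e0 ek.
  by rewrite ltNge; apply/negP => Me; apply: h; exists e; rewrite e0.
have e0 k : 0 < e k by have [/andP[]] := he k.
pose F k := M (e k).
have mF k : measurable (F k) by exact: mM.
have : (eta%:E <= P (lim_sup_set F))%E.
  have cv : P (\bigcup_(k >= n) F k) @[n --> \oo] --> P (lim_sup_set F).
    apply: lim_sup_set_cvg => //; rewrite ltey_eq fin_num_measure//.
    by apply: bigcup_measurable => k _.
  rewrite -(cvg_lim _ cv)//; apply: lime_ge.
    by apply/cvg_ex; eexists; exact: cv.
  apply: nearW => n; apply: (le_trans (he n).2); apply: le_measure;
    rewrite ?inE//.
  - exact: mF.
  - by apply: bigcup_measurable => k _.
  - by move=> w Mw; exists n => /=.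
suff -> : P (lim_sup_set F) = 0%E by rewrite lee_fin leNgt eta0.
have mL : measurable (lim_sup_set F).
  by apply: bigcap_measurable => // k _; apply: bigcup_measurable.
apply/(negligibleP P mL).
have nO : P.-negligible (~` Omega').
  apply/negligibleP; first exact: measurableC.
  by have := probability_setC P mO; rewrite PO subee.
apply: negligibleS (negligibleU nO (negligible_bigcup (fun k => MB _ (e0 k)))).
move=> w Lw; have [Ow|] := pselect (Omega' w); last by left.
right; apply: contrapT => nMB.
have [r /= r0 rB] := hB w Ow.
have [n nr] := ltr_add_invr r0; rewrite add0r in nr.
have [k /= nk Fk] := Lw n I.
apply: (rB (e k)) => //=.
  rewrite sub0r normrN gtr0_norm//; have [/andP[_ ek] _] := he k.
  apply: lt_trans ek _; apply: le_lt_trans nr.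
  by rewrite lef_pV2 ?posrE// ler_nat.
by apply: contrapT => nB; apply: nMB; exists k.
Qed.

End near_measure.

Section random_functionals.
Context d1 (Omega : measurableType d1) d2 (T : measurableType d2)
    (R : realType).
Variables (P : probability Omega R)
    (mu : {sigma_finite_measure set T -> \bar R}).
Variables (p : R) (p_gt1 : 1 < p) (p1 : (1 <= p%:E)%E).
Notation L := (LspaceType mu p1).
Notation LP := (LspaceType (P \x mu)%E p1).
Notation lift g := (Lspace_class (P \x mu)%E p1 (fun z => (g : L) z.2)).
Notation sect u w := (Lspace_class mu p1 (fun x => (u : LP) (w, x))).
Notation BL := (g_sigma_algebraType (@open L)).

Variables (Omega' : set Omega) (mOmega' : measurable Omega').
Hypothesis POmega' : P Omega' = 1%E.
Variables (E : R -> Omega -> L -> \bar R) (G : L -> \bar R).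
Hypothesis E_meas : forall e : R, 0 < e ->
  measurable_fun setT (fun z : (Omega * BL)%type => E e z.1 z.2).
Variables (C : R) (C0 : 0 < C).
Hypothesis E_coercive : forall (e : R) w, 0 < e -> Omega' w ->
  forall u, ((C^-1 * `|u| `^ p - C)%:E <= E e w u)%E.
Hypothesis E_compact : forall M : R, exists2 K : set L, compact K &
  forall (e : R) w u, 0 < e -> Omega' w -> (E e w u <= M%:E)%E -> K u.
Hypothesis E_gamma : forall w, Omega' w -> gamma_cvg0 (fun e => E e w) G.

Let p0 : 0 < p. Proof. exact: lt_trans p_gt1. Qed.

Lemma ae_Omega' : {ae P, forall w, Omega' w}.
Proof.
exists (~` Omega'); split => //; first exact: measurableC.
by have := probability_setC P mOmega'; rewrite POmega' subee.
Qed.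

Lemma measurable_continuous_snd (f : L -> R) : continuous f ->
  measurable_fun setT (fun z : (Omega * BL)%type => (f z.2)%:E).
Proof.
move=> /continuousP cf; apply/measurable_EFinP.
have mf : measurable_fun setT (f : BL -> R).
  move=> mT; apply: (measurability _ (RGenOpens.measurableE R)) => //.
  move=> _ [_ [a [b ->] <-]]; rewrite setTI; apply: sub_sigma_algebra.
  exact/cf/interval_open.
exact: measurableT_comp mf measurable_snd.
Qed.

Lemma continuous_affine (g : L) (kappa a0 : R) :
  continuous (fun v => kappa * spow_pairing g v + a0).
Proof.
move=> v.
have cp := @continuous_spow_pairing _ _ _ _ _ p_gt1 p1 g v.
have := @cvgMl_tmp _ _ (nbhs v) _ (spow_pairing g) kappa _ cp.
by move=> /(_ _)/cvgD; apply; exact: cvg_cst.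
Qed.

Lemma affine_coercive (g : L) (kappa a0 : R) : 0 <= kappa ->
  exists c, forall e w v, 0 < e -> Omega' w ->
    ((kappa * spow_pairing g v + a0 + (2 * C)^-1 * `|v| `^ p - c)%:E
      <= E e w v)%E.
Proof.
move=> k0; have s0 : 0 < (2 * C)^-1 by rewrite invr_gt0 mulr_gt0.
have [c hc] := spow_pairing_absorb p_gt1 g a0 k0 s0.
exists (c + C) => e w v e0 Ow; apply: le_trans (E_coercive e0 Ow v).
have -> : C^-1 = (2 * C)^-1 + (2 * C)^-1 by field; exact: lt0r_neq0.
rewrite lee_fin [X in _ <= X - _]mulrDl; have := hc v.
by move: ((2 * C)^-1 * _) => Y; lra.
Qed.

(** Below the affine function, the half of the coercivity kept in [affine_coercive] bounds the norm,
    hence the affine function and with it the energy. *)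
Lemma compact_affine_sublevel (g : L) (kappa a0 : R) : 0 <= kappa ->
  exists2 K : set L, compact K & forall e w v, 0 < e -> Omega' w ->
    (E e w v < (kappa * spow_pairing g v + a0)%:E)%E -> K v.
Proof.
move=> k0; have [c hc] := affine_coercive g a0 k0.
have s0 : 0 < (2 * C)^-1 by rewrite invr_gt0 mulr_gt0.
have [c' hc'] := spow_pairing_absorb p_gt1 g a0 k0 s0.
have [K cK EK] := E_compact (c + c'); exists K => // e w v e0 Ow Ev.
apply: (EK e w) => //; apply: (le_trans (ltW Ev)); rewrite lee_fin.
have := le_lt_trans (hc e w v e0 Ow) Ev; rewrite lte_fin => h.
by have := hc' v; move: h; move: ((2 * C)^-1 * _) => Y; lra.
Qed.

Let measurable_Omega'_fst (A : set (Omega * BL)) : measurable A ->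
  measurable ([set z : Omega * BL | Omega' z.1] `&` A).
Proof.
move=> mA; apply: measurableI => //.
by rewrite -[X in measurable X]setTI; exact: measurable_fst.
Qed.

Let measurable_strict_sublevel (f : Omega * BL -> \bar R) (e : R) : 0 < e ->
  measurable_fun setT f -> measurable ([set z : Omega * BL | Omega' z.1] `&`
    [set z | (E e z.1 z.2 < f z)%E]).
Proof.
move=> e0 mf; apply: measurable_Omega'_fst.
rewrite -[X in measurable X]setTI; apply: measurable_lte => //.
exact: E_meas.
Qed.

(* Off a set of small probability, the affine minorant of the Gamma-limit is
   almost a lower bound of [E e w]; elsewhere coercivity bounds the defect. *)
Lemma averaged_lower_bound (g : L) (kappa a0 s : R) : 0 <= kappa -> 0 < s ->
  (forall v b, (G v <= b%:E)%E -> kappa * spow_pairing g v + a0 <= b) ->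
  \forall e \near 0^'+, forall u : LP,
    ((kappa * spow_pairing (lift g) u + a0 - s)%:E
      <= \int[P]_w E e w (sect u w))%E.
Proof.
move=> k0 s0 GA; have s20 : 0 < s / 2 by rewrite divr_gt0.
have [K cK EK] := compact_affine_sublevel g a0 k0.
have [c hc] := affine_coercive g a0 k0.
pose A v := kappa * spow_pairing g v + a0.
(* The pairs where the minorant fails by more than s/2; the projection of [bad e] has a measurable
   version [M e], obtained by selection. *)
pose bad e := [set z : Omega * BL | Omega' z.1] `&`
  [set z | (E e z.1 z.2 < (A z.2 - s / 2)%:E)%E].
have mbad e : 0 < e -> measurable (bad e).
  move=> e0; apply: measurable_strict_sublevel => //.
  have := @measurable_continuous_snd (fun v =>
    kappa * spow_pairing g v + (a0 - s / 2))
    (@continuous_affine g kappa (a0 - s / 2)).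
  by congr measurable_fun; apply/funext => z; rewrite /A addrA.
have badK e z : 0 < e -> bad e z -> (\bigcup_(j : nat) K) z.2.
  move=> e0 [Ow Ez]; exists 0%N => //; apply: (EK e z.1) => //.
  by apply: lt_trans Ez _; rewrite lte_fin /A ltrBlDr ltrDl.
have /choice[M hM] e : exists M, 0 < e -> [/\ measurable M,
    fst @` bad e `<=` M & P.-negligible (M `\` fst @` bad e)].
  have [e0|e0] := ltP 0 e; last by exists set0.
  have [S [N [v [mS [mN N0] SN Sv _]]]] :=
    measurable_selection P (mbad e e0) (fun _ : nat => cK) (fun z =>
      badK e z e0).
  exists (S `|` N) => _; split => //; first exact: measurableU.
  exists N; split => // w [[Sw|//] nw]; exfalso; apply: nw.
  by exists (w, v w) => //; exact: Sv.
(* On [M e] the defect is at most [D], so a probability below s/(2D) costs at most s/2 in the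
   integral. *)
pose D := `|c| + 1.
have D0 : 0 < D by rewrite ltr_wpDl.
have eta0 : 0 < s / 2 / D by rewrite divr_gt0.
have badw w : Omega' w -> \forall e \near 0^'+, ~ (fst @` bad e) w.
  move=> Ow; have := @gamma_affine_minorant _ _ _ _ _ p_gt1 _ (fun e =>
    E e w) G K
    g kappa a0 (s / 2) (E_gamma Ow) cK (fun e v e0 => EK e w v e0 Ow) GA s20.
  apply: filterS => e he [[w' v] [Ow' Ev] /= ww']; rewrite -ww' in he.
  by move: Ev; rewrite /= ltNge he.
have mM e : 0 < e -> measurable (M e) by move=> e0; have [] := hM e e0.
have nM e : 0 < e -> P.-negligible (M e `\` fst @` bad e).
  by move=> e0; have [] := hM e e0.
have small := near_measure_lt mOmega' POmega' mM nM badw eta0.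
apply: filterS2 (nbhs_right_gt 0) small => e e0 PM u.
have [H iH [HE HI]] := spow_pairing_lift p_gt1 g u.
have [_ badM _] := hM e e0.
pose F w := (kappa%:E * H w + ((a0 - s / 2)%:E + (- D)%:E * (\1_(M e) w)%:E))%E.
have i1 : P.-integrable setT (fun w => (\1_(M e) w)%:E)
  by apply: integrable_indic; exact: mM.
have i2 : P.-integrable setT (fun w => ((- D)%:E * (\1_(M e) w)%:E)%E)
  by exact: integrableZl.
have i3 : P.-integrable setT (fun w : Omega => (a0 - s / 2)%:E)
  by exact: finite_measure_integrable_cst.
apply: (@le_trans _ _ (\int[P]_w F w)%E).
  rewrite /F integralD//; last 2 first.
  - exact: integrableZl.
  - exact: integrableD.
  have II : (\int[P]_w (\1_(M e) w)%:E = P (M e))%E.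
    by have := integral_indic P measurableT (mM e e0); rewrite setIT.
  rewrite integralZl// HI integralD// integralZl// II.
  rewrite integral_cst_probability.
  have PMfin : P (M e) \is a fin_num by apply: fin_num_measure; exact: mM.
  move: PM; rewrite -(fineK PMfin) lte_fin ltr_pdivlMr// => PM.
  by rewrite -!EFinM -!EFinD lee_fin; lra.
apply: le_integral_ae; apply: aeS2 ae_Omega' HE => w Ow Hw.
rewrite /F Hw -!EFinM -!EFinD indicE.
have [Mw|Mw] := pselect (M e w).
  apply: le_trans (hc e w (sect u w) e0 Ow); rewrite mem_set// mulr1 lee_fin.
  have : 0 <= (2 * C)^-1 * `|sect u w| `^ p.
    by rewrite mulr_ge0 ?powR_ge0// invr_ge0 mulr_ge0// ltW.
  by have := ler_norm c; rewrite /D; move: (_ * `|_| `^ p) => Y; lra.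
rewrite memNset// mulr0 addr0 leNgt; apply/negP => Ew; apply: Mw; apply: badM.
exists (w, sect u w) => //; split => //=; rewrite /A -addrA; exact: Ew.
Qed.

Hypothesis E_convex : forall (e : R) w, 0 < e -> Omega' w ->
  convex_functional (E e w).
Variables (psi : Omega -> R).
Hypothesis E_inf : forall (e : R) w, 0 < e -> Omega' w ->
  (ereal_inf (range (E e w)) <= (psi w)%:E)%E.

Lemma exists_low_energy e w (s : R) : 0 < e -> Omega' w -> 0 < s ->
  exists v, (E e w v < (psi w + s)%:E)%E.
Proof.
move=> e0 Ow s0; apply: contrapT => h; have := E_inf e0 Ow; apply/negP.
rewrite -ltNge; apply: (@lt_le_trans _ _ (psi w + s)%:E).
  by rewrite lte_fin ltrDl.
apply: le_ereal_inf_tmp => _ [v _ <-]; rewrite leNgt; apply/negP => Ev.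
by apply: h; exists v.
Qed.

Lemma gamma_limit_proper w : Omega' w -> exists v a, (G v <= a%:E)%E.
Proof.
move=> Ow; have [K cK EK] := E_compact (psi w + 1).
have k0 (k : nat) : 0 < k.+1%:R^-1 :> R by rewrite invr_gt0.
have /choice[x hx] (k : nat) : exists v,
  (E (k.+1%:R^-1) w v < (psi w + 1)%:E)%E.
  exact: exists_low_energy.
have Kx k : K (x k) by apply: EK (k0 k) Ow _; exact: ltW.
have [y Ky yx] := compact_cluster_seq cK Kx.
exists y, (psi w + 1); apply: (gamma_seq_le (E_gamma Ow)) => r r0.
have [n nr] := ltr_add_invr r0; rewrite add0r in nr.
have B : nbhs y [set v | `|v - y| < r].
  have := nbhsx_ballx y r r0; apply: filterS => v.
  by rewrite -ball_normE/= distrC.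
have [k nk xy] := yx _ B n.
exists k.+1%:R^-1, (x k); split => //; last exact: ltW.
rewrite k0/=; apply: le_lt_trans nr.
by rewrite lef_pV2 ?posrE// ler_nat.
Qed.

Lemma gamma_limit_compact w : Omega' w -> forall c, exists2 K : set L,
  compact K &
  forall v, (G v <= c%:E)%E -> K v.
Proof.
move=> Ow c; have [K cK EK] := E_compact (c + 1); exists K => // v.
apply: (gamma_sublevel (E_gamma Ow)) => [|e z e0 Ez]; last exact: EK e0 Ow Ez.
by apply: compact_closed => //; exact: norm_hausdorff.
Qed.

Lemma gamma_limit_ge w : Omega' w -> forall v, ((- C)%:E <= G v)%E.
Proof.
move=> Ow v; apply: (gamma_ge (E_gamma Ow)) => e z e0.
apply: le_trans (E_coercive e0 Ow z); rewrite lee_fin.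
have : 0 <= C^-1 * `|z| `^ p by rewrite mulr_ge0 ?powR_ge0// invr_ge0 ltW.
lra.
Qed.

(* Weak convergence in mean enters only through the functionals
   [spow_pairing (lift g)], which are the subgradients produced by the
   Moreau-Yosida regularization of [G]. *)
Lemma gamma_limit_le_recovery (u : L) (c : R) (v : R -> LP) :
  (forall g : L, spow_pairing (lift g) (v e) @[e --> 0^'+]
    --> spow_pairing g u) ->
  (\int[P]_w E e w (sect (v e) w))%E @[e --> 0^'+] --> c%:E ->
  (G u <= c%:E)%E.
Proof.
move=> vu Ec.
(* [G] is deterministic, so a single good sample yields its convexity, semicontinuity, properness
   and compact sublevels. *)
have [w Ow] : exists w, Omega' w.
  apply: contrapT => nO; have : Omega' = set0.
    by apply/seteqP; split => // w Ow; apply: nO; exists w.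
  by move=> O0; move: POmega'; rewrite O0 measure0 => /eqP;
    rewrite eq_sym onee_eq0.
have key (lam : R) : 0 < lam -> exists z a, [/\ (G z <= a%:E)%E, - C <= a &
    a + lam * p * `|u - z| `^ p <= c].
  move=> lam0; have lp0 : 0 <= lam * p by rewrite mulr_ge0 ?ltW.
  have [z [a [za sub]]] := Moreau_Yosida_subgradient p_gt1 (gamma_limit_ge Ow)
    (gamma_lsc (E_gamma Ow))
    (fun u v a b t t01 => gamma_convex (E_gamma Ow) t01 (fun e e0 =>
      E_convex e0 Ow))
    (gamma_limit_compact Ow) (gamma_limit_proper Ow) u lam0.
  exists z, a; split => //.
    by have := le_trans (gamma_limit_ge Ow z) za; rewrite lee_fin.
  pose g := u - z; pose kappa := lam * p;
    pose a0 := a - kappa * spow_pairing g z.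
  have GA x b : (G x <= b%:E)%E -> kappa * spow_pairing g x + a0 <= b.
    move=> /sub; rewrite (spow_pairingB p_gt1) mulrBr -/g -/kappa /a0; lra.
  have AE : a + lam * p * `|u - z| `^ p = kappa * spow_pairing g u + a0.
    rewrite /a0 -/g -/kappa -(spow_pairing_self p_gt1) {2}/g
      (spow_pairingB p_gt1).
    by rewrite mulrBr; ring.
  rewrite {}AE leNgt; apply/negP => cA.
  (* The gap is cut into quarters: one each for the averaged lower bound, the convergence of the
     energies and that of the pairings; the last gives the contradiction. *)
  have [s sE] : exists s, 4 * s = kappa * spow_pairing g u + a0 - c.
    by exists ((kappa * spow_pairing g u + a0 - c) / 4); field.
  have s0 : 0 < s by rewrite -(@pmulr_rgt0 _ 4)// sE subr_gt0.
  have lb := averaged_lower_bound lp0 s0 GA.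
  have cs : (c%:E < (c + s)%:E)%E by rewrite lte_fin ltrDl.
  have Ics : \forall e \near 0^'+,
      (\int[P]_w E e w (sect (v e) w) < (c + s)%:E)%E :=
        Ec _ (open_ereal_lt' cs).
  have kap0 : 0 < s / (kappa + 1) by rewrite divr_gt0// ltr_wpDl.
  have /cvgrPdist_lt/(_ _ kap0) vg := vu g.
  near (0 : R)^'+ => e.
  have h1 : (\int[P]_w E e w (sect (v e) w) < (c + s)%:E)%E by near: e.
  have h2 : ((kappa * spow_pairing (lift g) (v e) + a0 - s)%:E <=
      \int[P]_w E e w (sect (v e) w))%E.
    by near: e; apply: filterS lb => e; exact.
  have h3 : `|spow_pairing g u - spow_pairing (lift g) (v e)| < s / (kappa + 1).
    by near: e.
  have h4 : kappa * (spow_pairing g u - spow_pairing (lift g) (v e)) <= s.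
    apply: (@le_trans _ _ ((kappa + 1) * (s / (kappa + 1)))).
      apply: (@le_trans _ _ (kappa * (s / (kappa + 1)))).
        by rewrite ler_wpM2l// (le_trans (ler_norm _))// ltW.
      by rewrite ler_wpM2r// ?lerDl// ltW.
    by rewrite mulrC divfK// lt0r_neq0// ltr_wpDl.
  have := le_lt_trans h2 h1; rewrite lte_fin; move: h4; rewrite mulrBr.
  by move: sE; lra.
(* As [a] is at least [- C], a large [lam] forces [z] within [r] of [u], while [G z <= a <= c]. *)
apply: (gamma_lsc (E_gamma Ow)) => r r0.
have rp0 : 0 < r `^ p by exact: powR_gt0.
pose lam := (`|c + C| + 1) / (r `^ p * p).
have lam0 : 0 < lam by apply: divr_gt0; [exact: ltr_wpDl|exact: mulr_gt0].
have [z [a [za Ca h]]] := key lam lam0.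
have h0 : 0 <= lam * p * `|u - z| `^ p
  by rewrite mulr_ge0 ?powR_ge0// ltW// mulr_gt0.
exists z; last by apply: (le_trans za); rewrite lee_fin; lra.
rewrite ltNge; apply/negP => rz.
have : r `^ p <= `|u - z| `^ p.
  by rewrite distrC ge0_ler_powR ?nnegrE ?(ltW p0)// ltW.
move=> /(ler_wpM2l (ltW (mulr_gt0 lam0 p0))).
rewrite (_ : lam * p * r `^ p = `|c + C| + 1); last first.
  by rewrite /lam; field; rewrite !lt0r_neq0.
by have := ler_norm (c + C); lra.
Unshelve. all: by end_near. Qed.

Hypothesis psi_int : P.-integrable setT (EFin \o psi).

Let measurable_psi : measurable_fun setT psi.
Proof. by apply/measurable_EFinP; exact: measurable_int psi_int. Qed.

Let select_low_energy (e : R) : 0 < e -> exists S v, [/\ measurable S,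
  P S = 1%E,
  S `<=` Omega', approximable S v &
  forall w, S w -> (E e w (v w) < (psi w + 1)%:E)%E].
Proof.
move=> e0; pose A := [set z : Omega * BL | Omega' z.1] `&`
  [set z | (E e z.1 z.2 < (psi z.1 + 1)%:E)%E].
have mA : measurable A.
  apply: measurable_strict_sublevel => //.
  apply/measurable_EFinP; apply: measurable_funD => //.
  exact: measurableT_comp measurable_psi measurable_fst.
(* [psi] may be unbounded, so the low-energy points are covered by the compact sets of all integer
   levels. *)
have /choice[K hK] (j : nat) : exists K : set L, compact K /\
    forall e w v, 0 < e -> Omega' w -> (E e w v <= j%:R%:E)%E -> K v.
  by have [K cK EK] := E_compact j%:R; exists K.
have AK z : A z -> (\bigcup_j K j) z.2.
  move=> [Oz Ez]; exists (Num.truncn (psi z.1 + 1)).+1 => //.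
  apply: (hK _).2 e0 Oz _; apply: le_trans (ltW Ez) _; rewrite lee_fin ltW//.
  exact: truncnS_gt.
have [S [N [v [mS [mN N0] AS Sv aS]]]] :=
  measurable_selection P mA (fun j => (hK j).1) AK.
exists S, v; split => //; last by move=> w /Sv[].
- apply/eqP; rewrite eq_le probability_le1//=.
  have : (P Omega' <= P (S `|` N))%E.
    apply: le_measure; rewrite ?inE//; first exact: measurableU.
    move=> w Ow; have [x Ex] := exists_low_energy e0 Ow ltr01.
    by apply: AS; exists (w, x).
  rewrite POmega' => /le_trans; apply.
  have : (P (S `|` N) <= P S + P N)%E by exact: measureU2.
  by rewrite N0 adde0.
- by move=> w /Sv[].
Qed.

(** Through its own recovery sequence every sample in [Omega'] eventually lies in the projection of
    [A e]; [near_measure_lt] turns this into a small exceptional probability. *)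
Let select_recovery (u : L) (c rho : R) : (G u <= c%:E)%E -> 0 < rho ->
  forall eta : R, 0 < eta -> \forall e \near 0^'+, exists S v,
  [/\ measurable S, (P (~` S) < eta%:E)%E, approximable S v &
  forall w, S w -> [/\ Omega' w, (E e w (v w) < (c + rho)%:E)%E
    & `|v w - u| `^ p <= rho]].
Proof.
move=> uc rho0 eta eta0; pose r := rho `^ p^-1.
have r0 : 0 < r by exact: powR_gt0.
have rp : r `^ p = rho by rewrite /r -powRrM mulVf ?lt0r_neq0// powRr1// ltW.
pose A e := [set z : Omega * BL | Omega' z.1] `&`
  ([set z | (E e z.1 z.2 < (c + rho)%:E)%E] `&` (snd @^-1` ball u r)).
have mA e : 0 < e -> measurable (A e).
  move=> e0; apply: measurable_Omega'_fst; apply: measurableI;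
    rewrite -[X in measurable X]setTI.
    by apply: measurable_lte => //; exact: E_meas.
  apply: (measurable_snd measurableT); apply: sub_sigma_algebra.
  exact: ball_open.
have [K cK EK] := E_compact (c + rho).
have AK e z : 0 < e -> A e z -> (\bigcup_(j : nat) K) z.2.
  by move=> e0 [Oz [Ez _]]; exists 0%N => //; apply: EK e0 Oz _; exact: ltW.
have /choice[S hS] e : exists S, 0 < e -> [/\ measurable S,
    P.-negligible (~` S `\` ~` (fst @` A e)) & exists2 v, approximable S v &
      forall w, S w -> A e (w, v w)].
  have [e0|e0] := ltP 0 e; last by exists set0.
  have [S [N [v [mS [mN N0] SN Sv aS]]]] :=
    measurable_selection P (mA e e0) (fun _ : nat => cK) (fun z => AK e z e0).
  exists S => _; split => //; last by exists v.
  by exists N; split => // w [nS /contrapT/SN[]].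
have hA w : Omega' w -> \forall e \near 0^'+, ~ (~` (fst @` A e)) w.
  move=> Ow; have uc' : (G u < (c + rho)%:E)%E.
    by apply: le_lt_trans uc _; rewrite lte_fin ltrDl.
  have := gamma_recovery (E_gamma Ow) uc' r0.
  apply: filterS => e [z zu Ez]; apply; exists (w, z) => //.
  by split => //; split => //=; rewrite -ball_normE /= distrC.
have mSC e : 0 < e -> measurable (~` S e).
  by move=> e0; apply: measurableC; have [] := hS e e0.
have nS e : 0 < e -> P.-negligible (~` S e `\` ~` (fst @` A e)).
  by move=> e0; have [] := hS e e0.
have small := near_measure_lt mOmega' POmega' mSC nS hA eta0.
apply: filterS2 (nbhs_right_gt 0) small => e e0 PS.
have [mS _ [v aS Sv]] := hS e e0.
exists (S e), v; split => // w /Sv[Ow [Ew vu]]; split => //.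
rewrite -rp ge0_ler_powR ?nnegrE ?(ltW p0) ?(ltW r0)//.
by move: vu; rewrite /= -ball_normE /= distrC => /ltW.
Qed.

Lemma sect_sub (a b : LP) :
  {ae P, forall w, sect (a - b) w = sect a w - sect b w}.
Proof.
have /ae_eq_section ab := LspaceBE a b.
have ae1 := aeS2 (fun w => @conj _ _) (section_class_ae a) (section_class_ae b).
apply: aeS2 ab ae1 => w abw [aw bw].
apply: (section_class_eq (v := fun w => sect a w - sect b w)).
have ae2 := aeS2 (fun x => @conj _ _) aw bw.
have ae3 := aeS2 (fun x => @conj _ _) abw (LspaceBE (sect a w) (sect b w)).
apply: aeS2 ae2 ae3 => x [/(_ I) ax /(_ I) bx] [/(_ I) abx /(_ I) sx] _.
by rewrite abx sx /= ax bx.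
Qed.

Let integral_le_off (f : Omega -> \bar R) (h : Omega -> R) (M : set Omega)
    (a rho : R) :
  P.-integrable setT (EFin \o h) -> measurable M ->
  \int[P]_(w in M) `|h w| < rho ->
  {ae P, forall w, (f w <= (a + `|h w| * \1_M w)%:E)%E} ->
  (\int[P]_w f w <= (a + rho)%:E)%E.
Proof.
move=> ih mM hrho fle.
have inh : P.-integrable setT (fun w => `|h w|%:E) by exact: integrable_norm.
have inM : P.-integrable M (fun w => `|h w|%:E) by exact: integrableS inh.
have E1 : (fun w => (`|h w| * \1_M w)%:E) = (fun w => `|h w|%:E) \_ M.
  apply/funext => w; rewrite patchE indicE; case: (w \in M).
    by rewrite mulr1.
  by rewrite mulr0.
have i1 : P.-integrable setT (fun w => (`|h w| * \1_M w)%:E).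
  by rewrite E1; apply/integrable_restrict => //; rewrite setTI.
have i2 : P.-integrable setT (fun w : Omega => a%:E)
  by exact: finite_measure_integrable_cst.
apply: (@le_trans _ _ (\int[P]_w (a%:E + (`|h w| * \1_M w)%:E))%E).
  exact: le_integral_ae.
rewrite integralD// E1 -integral_mkcond EFinD; apply: leeD.
  by rewrite integral_cst_probability.
by move: hrho; rewrite /Rintegral -lte_fin fineK ?integrable_fin_num// => /ltW.
Qed.

Lemma averaged_recovery (u : L) (c delta : R) : (G u <= c%:E)%E -> 0 < delta ->
  \forall e \near 0^'+, exists x : LP, `|x - lift u| `^ p <= delta /\
    (\int[P]_w E e w (sect x w) <= (c + delta)%:E)%E.
Proof.
move=> uc delta0; pose rho := delta / 2.
have rho0 : 0 < rho by rewrite divr_gt0.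
have rhoE : delta = rho + rho by rewrite /rho -splitr.
(* [hE] bounds the energy of both selections, [g] the p-th power of their norm by coercivity, [hN]
   that of their distance to [u]; [h] serves for both integrals over the exceptional event. *)
pose hE w := `|psi w| + (1 + `|c| + rho).
pose g w := C * (hE w + C).
pose hN w := 2 `^ p * (g w + `|u| `^ p).
pose h w := hE w + hN w.
have hE0 w : 0 <= hE w by rewrite !addr_ge0// ltW.
have g0 w : 0 <= g w by rewrite mulr_ge0 ?addr_ge0// ltW.
have hN0 w : 0 <= hN w by rewrite mulr_ge0 ?addr_ge0 ?powR_ge0.
have h0 w : 0 <= h w by rewrite addr_ge0.
have icst k : P.-integrable setT (EFin \o (fun _ : Omega => k)).
  exact: finite_measure_integrable_cst.
have ihE : P.-integrable setT (EFin \o hE).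
  by apply: integrable_EFinD => //; exact: integrable_norm.
have ig : P.-integrable setT (EFin \o g).
  by apply: integrable_EFinZl; exact: integrable_EFinD.
have ih : P.-integrable setT (EFin \o h).
  by apply: integrable_EFinD => //; apply: integrable_EFinZl;
    exact: integrable_EFinD.
have [eta [eta0 heta]] := integral_normr_continuous ih rho0.
have := select_recovery uc rho0 eta0.
apply: filterS2 (nbhs_right_gt 0) => e e0 [S [v [mS PS aS Sv]]].
have [S' [v' [mS' PS' S'O aS' Sv']]] := select_low_energy e0.
(* The two pieces are disjoint, so the glued selection equals [v] on all of [S]. *)
pose SS n := if n is 0%N then S else S' `\` S.
pose vv n := if n is 0%N then v else v'.
have mSS n : measurable (SS n) by case: n => [|n] //=; exact: measurableD.
have aSS n : approximable (SS n) (vv n).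
  case: n => [|n] //= r r0; have [c' [i [mi hi]]] := aS' r r0.
  by exists c', i; split => // w [Sw _]; exact: hi.
have [x ax xv] := approximable_bigcup mSS aSS.
set U := \bigcup_n SS n in ax xv.
have mU : measurable U by exact: bigcupT_measurable.
have US' : S' `<=` U.
  by move=> w S'w; have [Sw|nSw] := pselect (S w); [exists 0%N|exists 1%N].
have PU : P U = 1%E.
  apply/eqP; rewrite eq_le probability_le1//= -PS'.
  by apply: le_measure; rewrite ?inE.
have UO w : U w -> Omega' w.
  by move=> [[|n] _ /=]; [move=> /Sv[]|move=> [/S'O]].
have xS w : S w -> x w = v w.
  move=> Sw; have Uw : U w by exists 0%N.
  by have [[|n] /= h1 ->] := xv w Uw => //; case: h1.
have xS' w : U w -> ~ S w -> x w = v' w /\ S' w.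
  by move=> Uw nSw; have [[|n] /= h1 ->] := xv w Uw; [|case: h1].
have Ex w : U w -> (E e w (x w) <= (c + rho + `|h w| * \1_(~` S) w)%:E)%E.
  move=> Uw; have [Sw|nSw] := pselect (S w).
    rewrite xS//; have [_ /ltW Ev _] := Sv w Sw; apply: (le_trans Ev).
    by rewrite lee_fin lerDl mulr_ge0.
  have [-> S'w] := xS' w Uw nSw; apply: (le_trans (ltW (Sv' w S'w))).
  rewrite lee_fin indicE mem_set// mulr1 (ger0_norm (h0 w)).
  have cN : - c <= `|c| by rewrite -normrN ler_norm.
  by have := hN0 w; have := ler_norm (psi w); rewrite /h /hE; lra.
have xg w : U w -> `|x w| `^ p <= g w.
  move=> Uw; have EhE : (E e w (x w) <= (hE w)%:E)%E.
    have [Sw|nSw] := pselect (S w).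
      rewrite xS//; have [_ /ltW Ev _] := Sv w Sw; apply: (le_trans Ev).
      by rewrite lee_fin /hE; have := ler_norm c; have := normr_ge0 (psi w);
        lra.
    have [-> S'w] := xS' w Uw nSw; apply: (le_trans (ltW (Sv' w S'w))).
    rewrite lee_fin /hE; have := ler_norm (psi w); have := normr_ge0 c; lra.
  have := le_trans (E_coercive e0 (UO w Uw) (x w)) EhE.
  by rewrite lee_fin lerBlDr mulrC ler_pdivrMr// mulrC.
have [X hX] := Lspace_of_sections mU PU ax ig xg.
have Uae : {ae P, forall w, U w}.
  exists (~` U); split => //; first exact: measurableC.
  by have := probability_setC P mU; rewrite PU subee.
have hS : \int[P]_(w in ~` S) `|h w| < rho by apply: heta => //;
  exact: measurableC.
exists X; split.
  have D : {ae P, forall w, sect (X - lift u) w = x w - u}.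
    have ae1 := aeS2 (fun w => @conj _ _) hX (sect_lift_ae P u).
    by apply: aeS2 ae1 (sect_sub X (lift u)) => w [-> ->].
  have [F mF [FE NF]] := Lspace_normX_sections D.
  rewrite -lee_fin NF rhoE.
  apply: (integral_le_off ih (measurableC mS) hS).
  apply: aeS2 Uae FE => w Uw ->; rewrite lee_fin.
  have [Sw|nSw] := pselect (S w).
    rewrite xS//; have [_ _ vu] := Sv w Sw; apply: (le_trans vu).
    by rewrite lerDl mulr_ge0.
  rewrite indicE mem_set// mulr1 (ger0_norm (h0 w)).
  apply: (@le_trans _ _ (hN w)); last by have := hE0 w; rewrite /h; lra.
  apply: (@le_trans _ _ ((`|x w| + `|u|) `^ p)).
    by rewrite ge0_ler_powR ?nnegrE ?addr_ge0 ?(ltW p0)// ler_normB.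
  apply: (le_trans (powR_add_le p_gt1 (normr_ge0 _) (normr_ge0 _))).
  by rewrite ler_wpM2l ?powR_ge0// lerD2r xg.
rewrite rhoE addrA; apply: (integral_le_off ih (measurableC mS) hS).
by apply: aeS2 Uae hX => w Uw ->; exact: Ex.
Qed.

End random_functionals.

(** * Diagonal argument and conclusion *)

Lemma diagonal_family (R : realType) (S : Type) (s0 : S)
    (A : nat -> R -> S -> Prop) :
  (forall j e x, A j.+1 e x -> A j e x) ->
  (forall j, \forall e \near 0^'+, exists x, A j e x) ->
  exists x : R -> S, forall j, \forall e \near 0^'+, A j e (x e).
Proof.
move=> AS Aex.
have Ale i j e x : (i <= j)%N -> A j e x -> A i e x.
  by move=> /subnKC <-; elim: (j - i)%N => [|k IH];
    rewrite ?addn0// addnS => /AS.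
have /choice[x hx] e : exists x, forall j, j.+1%:R < e^-1 ->
    (exists y, A j e y) -> A j e x.
  (* At scale [e] only the levels below the integer part of 1/e compete; an element of the highest
     inhabited one is taken, and the levels being nested it serves all lower ones. *)
  pose m := Num.truncn e^-1.
  have : exists x, forall j, (j < m)%N -> (exists y, A j e y) -> A j e x.
    elim: m => [|m [x hx]]; first by exists s0.
    have [[y Ay]|nA] := pselect (exists y, A m e y).
      by exists y => j; rewrite ltnS => jm _; exact: Ale Ay.
    exists x => j; rewrite ltnS leq_eqVlt => /predU1P[->//|]; exact: hx.
  move=> [x hx]; exists x => j je; apply: hx; rewrite /m.
  by rewrite truncn_gt_nat ltW.
exists x => j; have j0 : 0 < j.+1%:R^-1 :> R by rewrite invr_gt0.
apply: filterS3 (nbhs_right_gt 0) (nbhs_right_lt j0) (Aex j) => e e0 ej Ae.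
by apply: hx => //; rewrite -[ltLHS]invrK ltf_pV2 ?posrE ?invr_gt0.
Qed.

Lemma liminf0_le (R : realType) (f : R -> \bar R) (M : \bar R) :
  (\forall e \near 0^'+, (f e <= M)%E) -> (liminf0 f <= M)%E.
Proof.
move=> fM; rewrite /liminf0 limf_einfE; apply: ge_ereal_sup => _ [B /= B0 <-].
have [e [Be fe]] := filter_ex (filterI B0 fM).
by apply: le_trans fe; apply: ereal_inf_lbound; exists e.
Qed.

Lemma Lspace_norm_le_sobolev_norm (R : realType) (n : nat) (Q : set 'rV[R]_n)
    (oQ : open Q) (p : R) (p_gt1 : 1 < p) (u : Lp_Q oQ p_gt1) :
  ((`|u| `^ p)%:E <= (sobolev_norm u) `^ p)%E.
Proof.
have p0 : 0 < p := lt_trans ltr01 p_gt1.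
rewrite /sobolev_norm; case: ifP => _; last first.
  by rewrite poweRyr ?leey// gt_eqF.
have s0 : 0 <= \sum_(i < n) `|wpartial u i| `^ p.
  by apply: sumr_ge0 => i _; exact: powR_ge0.
rewrite poweR_EFin -powRrM mulVf ?lt0r_neq0// powRr1 ?addr_ge0 ?powR_ge0//.
by rewrite lee_fin lerDl.
Qed.

Theorem proposition3p10 (R : realType) (d : measure_display)
  (Omega : measurableType d) (P : probability Omega R) (n : nat)
  (tau : 'rV[R]_n -> Omega -> Omega)
  (Omega_cg : countably_generated Omega)
  (tau_flow : measure_preserving_flow P tau)
  (tau_ergodic : ergodic P tau)
  (p : R) (p_gt1 : 1 < p)
  (Q : set 'rV[R]_n) (oQ : open Q)
  (T : R -> Lp_OmegaQ P oQ p_gt1 -> Lp_OmegaQ P oQ p_gt1)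
  (T_unfolding : forall e : R, 0 < e -> unfolding tau e (T e))
  (E : R -> Omega -> Lp_Q oQ p_gt1 -> \bar R)
  (E_Ny : forall (e : R) w u, 0 < e -> E e w u != -oo%E)
  (Omega' : set Omega) (mOmega' : measurable Omega') (POmega' : P Omega' = 1%E)
  (C : R) (C_gt0 : 0 < C)
  (psi : Omega -> R) (psi_L1 : psi \in Lfun P 1)
  (E_measurable : forall e : R, 0 < e -> measurable_fun setT
    (fun z : (Omega * g_sigma_algebraType (@open (Lp_Q oQ p_gt1)))%type =>
       E e z.1 z.2))
  (E_lower_bound : forall (e : R) w, 0 < e -> Omega' w ->
    forall u, ((- C)%:E <= E e w u)%E)
  (E_inf : forall (e : R) w, 0 < e -> Omega' w ->
    (ereal_inf (range (E e w)) <= (psi w)%:E)%E)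
  (E_convex : forall (e : R) w, 0 < e -> Omega' w ->
    convex_functional (E e w))
  (E_proper : forall (e : R) w, 0 < e -> Omega' w ->
    proper_functional (E e w))
  (E_lsc : forall (e : R) w, 0 < e -> Omega' w ->
    lower_semicontinuous (E e w))
  (X : set (Lp_Q oQ p_gt1))
  (E_dom : forall (e : R) w, 0 < e -> Omega' w -> edom (E e w) = X)
  (X_sobolev : X `<=` @sobolev R n Q oQ p (lt1_le1e p_gt1))
  (X_convex : convex_set X)
  (X_closed : sobolev_closed X)
  (X_compact : compactly_embedded X)
  (E_coercive : forall (e : R) w, 0 < e -> Omega' w ->
    forall u, ((C^-1)%:E * (sobolev_norm u) `^ p - C%:E <= E e w u)%E)
  (Ehom Ehom' : Lp_Q oQ p_gt1 -> \bar R)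
  (Ehom_Ny : forall u, Ehom u != -oo%E)
  (Ehom'_Ny : forall u, Ehom' u != -oo%E)
  (E_gamma : forall w, Omega' w -> gamma_cvg0 (fun e => E e w) Ehom)
  (E_two_scale : two_scale_gamma_cvg T (fun e => averaged (E e)) Ehom') :
  Ehom = Ehom'.
Proof.
have p0 : 0 < p := lt_trans ltr01 p_gt1.
have Ci0 : 0 < C^-1 by rewrite invr_gt0.
have coer (e : R) w : 0 < e -> Omega' w ->
    forall u, ((C^-1 * `|u| `^ p - C)%:E <= E e w u)%E.
  move=> e0 Ow u; apply: le_trans (E_coercive e w e0 Ow u).
  rewrite EFinB EFinM; apply: leeB => //; apply: lee_wpmul2l.
    by rewrite lee_fin ltW.
  exact: Lspace_norm_le_sobolev_norm.
have cpt (M : R) : exists2 K : set (Lp_Q oQ p_gt1), compact K &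
    forall (e : R) w u, 0 < e -> Omega' w -> (E e w u <= M%:E)%E -> K u.
  (* Coercivity turns the energy bound [M] into the Sobolev bound [M'], to which the compact
     embedding of [X] applies. *)
  pose M' := (C * (M + C)) `^ p^-1.
  have := X_compact M'; rewrite precompactE => cK.
  exists (closure [set u | X u /\ (sobolev_norm u <= M'%:E)%E]) =>
    // e w u e0 Ow Eu.
  apply: subset_closure; split.
    by rewrite -(E_dom e w e0 Ow) /edom /=; apply: le_lt_trans Eu _;
      exact: ltry.
  have := le_trans (E_coercive e w e0 Ow u) Eu.
  rewrite /sobolev_norm; case: ifP => _.
    rewrite poweR_EFin -EFinM -EFinB !lee_fin.
    set s := (_ + _) `^ _; have s0 : 0 <= s by exact: powR_ge0.
    rewrite lerBlDr mulrC ler_pdivrMr// => h.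
    have -> : s = (s `^ p) `^ p^-1 by rewrite -powRrM mulfV ?powRr1// lt0r_neq0.
    rewrite /M' ge0_ler_powR ?invr_ge0 ?(ltW p0) ?nnegrE ?powR_ge0 1?mulrC//.
    by apply: le_trans h; exact: powR_ge0.
  by rewrite poweRyr ?gt_eqF// gt0_muley ?lte_fin// addye// leye_eq.
have psi_int : P.-integrable setT (EFin \o psi) by exact/Lfun1_integrable.
have pcts (g : Lp_Q oQ p_gt1) := @continuous_spow_pairing _ _ _ _ _ p_gt1
  (lt1_le1e p_gt1) (lift_const P g).
apply/funext => u; apply/eqP; rewrite eq_le; apply/andP; split.
  have [v vu Ev] := E_two_scale.2 u.
  case Eu : (Ehom' u) => [c| |]; last 2 first.
  - exact: leey.
  - by have := Ehom'_Ny u; rewrite Eu.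
  rewrite Eu in Ev.
  apply: (gamma_limit_le_recovery p_gt1 mOmega' POmega' E_measurable C_gt0 coer
    cpt E_gamma E_convex E_inf _ Ev) => g.
  rewrite -(spow_pairing_lift_lift P p_gt1 g u).
  (* Weak convergence concerns the unfolded family; as [T e] is an isometry fixing the lift of [g],
     the pairings are those of [v e] itself. *)
  have := vu (spow_functional p_gt1 (lift_const P g)) (pcts g).
  apply: cvg_trans; apply: near_eq_cvg; near=> e.
  have e0 : 0 < e by [].
  have [linT isoT _ _] := T_unfolding e e0.
  apply: (spow_pairing_isometry p_gt1) => //.
  exact: unfolding_lift_const (T_unfolding e e0).
case Eu : (Ehom u) => [c| |]; last 2 first.
- exact: leey.
- by have := Ehom_Ny u; rewrite Eu.
have uc : (Ehom u <= c%:E)%E by rewrite Eu.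
(* Level [j] of the diagonal scheme asks for accuracy 1/(j+1) both in the distance to the lift and
   in the energy. *)
pose A j e (x : Lp_OmegaQ P oQ p_gt1) :=
  `|x - lift_const P u| `^ p <= j.+1%:R^-1 /\
  (averaged (E e) x <= (c + j.+1%:R^-1)%:E)%E.
have AS j e x : A j.+1 e x -> A j e x.
  have jj : j.+2%:R^-1 <= j.+1%:R^-1 :> R by rewrite lef_pV2 ?posrE// ler_nat.
  move=> [h1 h2]; split; first exact: le_trans jj.
  by apply: (le_trans h2); rewrite lee_fin lerD2l.
have Aex j : \forall e \near 0^'+, exists x, A j e x.
  have j0 : 0 < j.+1%:R^-1 :> R by rewrite invr_gt0.
  exact: (averaged_recovery p_gt1 mOmega' POmega' E_measurable C_gt0 coer
    cpt E_gamma E_inf psi_int uc j0).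
have [x hx] := diagonal_family 0 AS Aex.
have xu : x e @[e --> 0^'+] --> lift_const P u.
  apply/cvgrPdist_lt => r r0; have rp0 : 0 < r `^ p by exact: powR_gt0.
  have [j jr] := ltr_add_invr rp0; rewrite add0r in jr.
  apply: filterS (hx j) => e [xj _]; rewrite distrC.
  rewrite ltNge; apply/negP => rx.
  have : r `^ p <= `|x e - lift_const P u| `^ p.
    by rewrite ge0_ler_powR ?nnegrE ?(ltW p0)// ltW.
  by move=> /le_trans/(_ xj)/le_lt_trans/(_ jr); rewrite ltxx.
have Eu' := E_two_scale.1 u x (strong_two_scale_cvg T_unfolding xu).
apply/lee_addgt0Pr => s s0; have [j js] := ltr_add_invr s0; rewrite add0r in js.
apply: (le_trans Eu'); apply: liminf0_le; apply: filterS (hx j) => e [_ Ej].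
by apply: (le_trans Ej); rewrite -EFinD lee_fin lerD2l ltW.
Unshelve. all: by end_near. Qed.
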